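(* Let $A$ be an algebra of $\mathcal{V}$ such that $K(A)$ is closed under the commutator operation. If $A$ verifies the condition $(\star)$, then the following are equivalent: (1) $A$ is a congruence normal algebra; (2) $Spec_Z(A)$ is a normal space; (3) the inclusion $Max_Z(A)\subseteq Spec_Z(A)$ has a continuous retraction $\gamma:Spec_Z(A)\rightarrow Max_Z(A)$; (4) if $\phi\in Max(A)$, then $\Lambda(\phi)$ is a closed subset of $Spec_Z(A)$; (5) if $\phi,\psi$ are two distinct maximal congruences of $A$, then $Vir(\phi)\vee Vir(\psi)=\nabla_A$; (6) for all $\theta\in Con(A)$ and $\phi\in Max(A)$, $Vir(\theta)\subseteq\phi$ implies $\theta\subseteq\phi$; (7) for all $\theta\in Con(A)$, $Max(A)\cap V(\theta)=Max(A)\cap V(Vir(\theta))$; (8) for all $\theta\in Con(A)$, $Rad(\theta)=Rad(Vir(\theta))$; (9) the function $\eta:Max_Z(A)\rightarrow Spec_Z(VCon(A))$, defined by the assignment $\phi\mapsto Vir(\phi)$, is a homeomorphism.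
   Context: $\mathcal{V}$ is a fixed congruence-modular variety of algebras (of a finite signature) that is semidegenerate: no nontrivial algebra in $\mathcal{V}$ has one-element subalgebras (equivalently, $\nabla_A$ is compact in $Con(A)$ for every $A\in\mathcal{V}$). For $A\in\mathcal{V}$, $Con(A)$ is the complete lattice of congruences of $A$, with least element $\Delta_A$ and greatest element $\nabla_A$; $K(A)$ is the set of compact (= finitely generated) congruences; $Max(A)$ is the set of maximal (proper) congruences. Commutator: $[\cdot,\cdot]=[\cdot,\cdot]_A$ is the (modular) commutator, i.e. the greatest operation on the congruence lattices of members of $\mathcal{V}$ such that for every surjective morphism $f:A\to B$ in $\mathcal{V}$ and all $\alpha,\beta\in Con(A)$: $[\alpha,\beta]_A\subseteq\alpha\cap\beta$ and $[\alpha,\beta]_A\vee Ker(f)=f^{-1}([f(\alpha\vee Ker(f)),f(\beta\vee Ker(f))]_B)$. Put $\alpha^{\perp}=\bigvee\{\gamma\in Con(A)\mid[\alpha,\gamma]=\Delta_A\}$. Iterates: $[\alpha,\alpha]^0=\alpha$, $[\alpha,\beta]^1=[\alpha,\beta]$, $[\alpha,\beta]^{n+1}=[[\alpha,\beta]^n,[\alpha,\beta]^n]$. Condition $(\star)$: for all $\alpha,\beta\in K(A)$ and every integer $n\geq 1$ there is an integer $m\geq 0$ with $[[\alpha,\alpha]^m,[\beta,\beta]^m]\subseteq[\alpha,\beta]^n$. $\phi\in Con(A)\setminus\{\nabla_A\}$ is prime if $[\alpha,\beta]\subseteq\phi$ implies $\alpha\subseteq\phi$ or $\beta\subseteq\phi$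 (for $\alpha,\beta\in Con(A)$); $Spec(A)$ is the set of prime congruences, and $Max(A)\subseteq Spec(A)$. For $\theta\in Con(A)$, $V(\theta)=\{\phi\in Spec(A)\mid\theta\subseteq\phi\}$, $D(\theta)=Spec(A)\setminus V(\theta)$; $Spec_Z(A)$ is $Spec(A)$ with the Zariski topology whose open sets are the $D(\theta)$, $\theta\in Con(A)$, and $Max_Z(A)$ is $Max(A)$ with the subspace topology. For $\phi\in Spec(A)$, $\Lambda(\phi)=\{\psi\in Spec(A)\mid\psi\subseteq\phi\}$. $Rad(\theta)=\bigcap(Max(A)\cap V(\theta))$. ''Normal space'' means that disjoint closed sets have disjoint open neighbourhoods (no separation axiom such as $T_1$ is assumed). $A$ is congruence normal if for all $\theta,\nu\in Con(A)$ with $\theta\vee\nu=\nabla_A$ there exist $\alpha,\beta\in Con(A)$ with $\theta\vee\alpha=\nu\vee\beta=\nabla_A$ and $[\alpha,\beta]=\Delta_A$. $\theta\in Con(A)$ is pure if for every $\alpha\in K(A)$ with $\alpha\subseteq\theta$ one has $\theta\vee\alpha^{\perp}=\nabla_A$; $VCon(A)$ is the set of pure congruences, a frame under the joins of $Con(A)$ and finite intersections. $Vir(\theta)=\bigvee\{\alpha\in VCon(A)\mid\alpha\subseteq\theta\}$, the largest pure congruence contained in $\theta$. A proper pure congruence $\theta$ is purely-prime if for all $\chi,\varepsilon\in VCon(A)$, $[\chi,\varepsilon]\subseteq\theta$ implies $\chi\subseteq\theta$ or $\varepsilon\subseteq\theta$ (for pure congruences $[\chi,\varepsilon]=\chi\cap\varepsilon$).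 $Spec_Z(VCon(A))$ is the set of purely-prime congruences (the prime spectrum of the frame $VCon(A)$) with open sets $\{\phi\mid\theta\not\subseteq\phi\}$, $\theta\in VCon(A)$; one has $Vir(\phi)\in Spec(VCon(A))$ for $\phi\in Spec(A)$. *)

(* Defs.v *)
From HB Require Import structures.
From mathcomp Require Import all_boot.
From mathcomp Require Import all_classical.
From mathcomp Require Import topology separation_axioms.

Set Implicit Arguments.
Unset Strict Implicit.
Unset Printing Implicit Defensive.

Local Open Scope classical_set_scope.

Record signature := Signature {
  symbol : finType;
  arity : symbol -> nat }.

Record algebra (S : signature) := Algebra {
  carrier :> Type;
  op : forall o : symbol S, ('I_(arity o) -> carrier) -> carrier;
  carrier_inhabited : inhabited carrier }.

Arguments op {S} a o _.

Definition is_hom (S : signature) (A B : algebra S) (f : A -> B) :=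
  forall (o : symbol S) (x : 'I_(arity o) -> A),
    f (op A o x) = op B o (f \o x).

Lemma prod_inhabited (S : signature) (I : Type) (F : I -> algebra S) :
  inhabited (forall i, F i).
Proof.
have h i : exists x : F i, True by have [x] := carrier_inhabited (F i); exists x.
exact: (inhabits (fun i => projT1 (cid (h i)))).
Qed.

Definition prod_algebra (S : signature) (I : Type) (F : I -> algebra S) :
    algebra S :=
  @Algebra S (forall i, F i) (fun o x i => op (F i) o (x^~ i))
    (prod_inhabited F).

(* Closure under subalgebras is stated through embeddings: up to isomorphism,
   which [variety_H] absorbs, the subalgebras of B are the algebras embedded
   in B. *)
Record variety (S : signature) := Variety {
  variety_mem : algebra S -> Prop;
  variety_H : forall (A B : algebra S) (f : A -> B),
    is_hom f -> (forall y, exists x, f x = y) ->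
    variety_mem A -> variety_mem B;
  variety_S : forall (A B : algebra S) (f : A -> B),
    is_hom f -> injective f -> variety_mem B -> variety_mem A;
  variety_P : forall (I : Type) (F : I -> algebra S),
    (forall i, variety_mem (F i)) -> variety_mem (prod_algebra F) }.

Record member (S : signature) (V : variety S) := Member {
  member_algebra :> algebra S;
  member_mem : variety_mem V member_algebra }.

Record con (S : signature) (A : algebra S) := Con {
  con_rel :> A -> A -> Prop;
  con_refl : forall x, con_rel x x;
  con_sym : forall x y, con_rel x y -> con_rel y x;
  con_trans : forall x y z, con_rel x y -> con_rel y z -> con_rel x z;
  con_op : forall (o : symbol S) (x y : 'I_(arity o) -> A),
    (forall i, con_rel (x i) (y i)) -> con_rel (op A o x) (op A o y) }.

Declare Scope con_scope.
Delimit Scope con_scope with con.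
Bind Scope con_scope with con.

Section CongruenceLattice.
Context {S : signature} {A : algebra S}.
Implicit Types (a b t : con A) (X : set (con A)).

Definition con_le a b := forall x y, a x y -> b x y.

Lemma con_le_anti a b : con_le a b -> con_le b a -> a = b.
Proof.
case: a b => [r ? ? ? ?] [r' ? ? ? ?] /= h h'.
have e : r = r' by apply/funext => x; apply/funext => y; apply/propext; split;
  [exact: h | exact: h'].
by subst r'; congr Con; exact: Prop_irrelevance.
Qed.

Definition con_bot : con A.
Proof.
exists (fun x y => x = y) => //; first by move=> x y z -> ->.
by move=> o x y /funext ->.
Defined.

Definition con_top : con A.
Proof. by exists (fun _ _ => True). Defined.

Definition con_inf X : con A.
Proof.
exists (fun x y => forall t, X t -> t x y).
- by move=> x t _; exact: con_refl.
- by move=> x y h t Xt; apply: con_sym; exact: h.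
- by move=> x y z h k t Xt; apply: con_trans (h t Xt) (k t Xt).
- by move=> o x y h t Xt; apply: con_op => i; exact: h.
Defined.

Definition con_sup X : con A :=
  con_inf [set t | forall a, X a -> con_le a t].

Definition con_meet a b := con_inf [set a; b].
Definition con_join a b := con_sup [set a; b].

Definition con_compact t := forall X, con_le t (con_sup X) ->
  exists Y, [/\ finite_set Y, Y `<=` X & con_le t (con_sup Y)].

Definition con_maximal t :=
  t <> con_top /\ forall a, con_le t a -> a = t \/ a = con_top.

End CongruenceLattice.

Notation "a <=c b" := (con_le a%con b%con)
  (at level 70, no associativity) : type_scope.
Notation "a /\c b" := (con_meet a b)
  (at level 40, left associativity) : con_scope.
Notation "a \/c b" := (con_join a b)
  (at level 50, left associativity) : con_scope.
Notation "'Delta" := (@con_bot _ _) (at level 0) : con_scope.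
Notation "'Nabla" := (@con_top _ _) (at level 0) : con_scope.

Local Open Scope con_scope.

Section CongruenceLatticeTheory.
Context {S : signature} {A : algebra S}.
Implicit Types (a b t : con A) (X : set (con A)).

Lemma con_le_trans a b t : a <=c b -> b <=c t -> a <=c t.
Proof. by move=> h k x y /h /k. Qed.

Lemma con_sup_ub X a : X a -> a <=c con_sup X.
Proof. by move=> Xa x y axy t ht; exact: (ht a Xa). Qed.

Lemma con_sup_le X t : (forall a, X a -> a <=c t) -> con_sup X <=c t.
Proof. by move=> h x y sxy; exact: (sxy t h). Qed.

Lemma con_joinl a b : a <=c a \/c b.
Proof. by apply: con_sup_ub; left. Qed.

Lemma con_joinr a b : b <=c a \/c b.
Proof. by apply: con_sup_ub; right. Qed.

Lemma con_join_le a b t : a <=c t -> b <=c t -> a \/c b <=c t.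
Proof. by move=> h k; apply: con_sup_le => _ [] ->. Qed.

Lemma con_meet_le a b t : t <=c a /\c b <-> t <=c a /\ t <=c b.
Proof.
split=> [h|[h k] x y txy _ [] ->]; [|exact: h|exact: k].
by split=> x y /h; apply; [left|right].
Qed.

Lemma con_properP t : ~ 'Nabla <=c t <-> t <> 'Nabla.
Proof.
split=> [h e|h k]; first by apply: h; rewrite e.
by apply: h; apply: con_le_anti.
Qed.

End CongruenceLatticeTheory.

Record epi (S : signature) (A B : algebra S) := Epi {
  epi_fun :> A -> B;
  epi_hom : is_hom epi_fun;
  epi_surj : forall y, exists x, epi_fun x = y }.

Section Epi.
Context {S : signature} {A B : algebra S} (f : epi A B).

Definition con_preim (t : con B) : con A.
Proof.
exists (fun x y => t (f x) (f y)).
- by move=> x; exact: con_refl.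
- by move=> x y; exact: con_sym.
- by move=> x y z; exact: con_trans.
- by move=> o x y h; rewrite !epi_hom; exact: con_op.
Defined.

Definition con_ker : con A := con_preim 'Delta.

(* The congruence f(t \/ Ker f) of B. *)
Definition con_image (t : con A) : con B.
Proof.
exists (fun u v => exists x y, [/\ f x = u, f y = v & (t \/c con_ker) x y]).
- by move=> u; have [x <-] := epi_surj f u; exists x, x; split=> //;
    exact: con_refl.
- by move=> u v [x [y [fx fy h]]]; exists y, x; split=> //; exact: con_sym.
- move=> u v w [x [y [fx fy h]]] [y' [z [fy' fz k]]].
  exists x, z; split=> //; apply: con_trans h _.
  by apply: con_trans k; apply: con_joinr; rewrite /= fy fy'.
- move=> o u v h.
  have [x hx] := choice h; have [y hy] := choice hx.
  exists (op A o x), (op A o y); split; rewrite ?epi_hom.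
  + by congr op; apply/funext => i; have [] := hy i.
  + by congr op; apply/funext => i; have [] := hy i.
  + by apply: con_op => i; have [] := hy i.
Defined.

End Epi.

Section Commutator.
Context {S : signature} (V : variety S).

Definition con_operation := forall A : member V, con A -> con A -> con A.

Definition commutator_axioms (D : con_operation) :=
  (forall (A : member V) (a b : con A), D A a b <=c a /\c b) /\
  (forall (A B : member V) (f : epi A B) (a b : con A),
    D A a b \/c con_ker f
      = con_preim f (D B (con_image f a) (con_image f b))).

(* The greatest operation satisfying [commutator_axioms], as established by
   [commutatorP] and [commutator_greatest]. *)
Definition commutator : con_operation := fun A a b =>
  con_sup [set D A a b | D in commutator_axioms].

Lemma commutator_greatest (D : con_operation) : commutator_axioms D ->
  forall (A : member V) (a b : con A), D A a b <=c commutator a b.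
Proof. by move=> hD A a b; apply: con_sup_ub; exists D. Qed.

Lemma commutator_le_meet (A : member V) (a b : con A) :
  commutator a b <=c a /\c b.
Proof. by apply: con_sup_le => _ [D [hD _] <-]; exact: hD. Qed.

Lemma commutatorP : commutator_axioms commutator.
Proof.
split=> [|A B f a b]; first exact: commutator_le_meet.
apply: con_le_anti.
  apply: con_join_le => [|x y fxy]; last first.
    change (commutator (con_image f a) (con_image f b) (f x) (f y)).
    have -> : f x = f y := fxy.
    exact: con_refl.
  apply: con_sup_le => _ [D hD <-].
  apply: con_le_trans (@con_joinl _ _ _ (con_ker f)) _.
  rewrite (hD.2 A B f a b) => x y Dxy.
  exact: (commutator_greatest hD Dxy).
set t := _ \/c _.
have h : commutator (con_image f a) (con_image f b) <=c con_image f t.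
  apply: con_sup_le => _ [D hD <-] u v Duv.
  have [x fx] := epi_surj f u; have [y fy] := epi_surj f v.
  exists x, y; split=> //; apply: con_joinl; subst u v.
  have : con_preim f (D B (con_image f a) (con_image f b)) x y by [].
  rewrite -(hD.2 A B f a b) => E.
  apply: (con_join_le _ _ E); last exact: con_joinr.
  apply: con_le_trans (@con_joinl _ _ _ _).
  exact: (commutator_greatest hD).
move=> x y /h [x' [y' [fx fy k]]].
have kt : t \/c con_ker f <=c t by apply: con_join_le => //; exact: con_joinr.
have kert : con_ker f <=c t by exact: con_joinr.
apply: (@con_trans _ _ t _ x'); first exact: kert.
by apply: (@con_trans _ _ t _ y'); [exact: kt | exact: kert].
Qed.

End Commutator.

Definition congruence_modular (S : signature) (V : variety S) :=
  forall (A : member V) (a b t : con A),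
    a <=c t -> (a \/c b) /\c t = a \/c (b /\c t).

Definition one_element_subalgebra (S : signature) (A : algebra S) (x : A) :=
  forall o : symbol S, op A o (fun=> x) = x.

Definition semidegenerate (S : signature) (V : variety S) :=
  forall A : member V, (exists x y : A, x <> y) ->
    ~ exists x : A, one_element_subalgebra x.

Section Algebra.
Context {S : signature} {V : variety S} (A : member V).
Implicit Types (a b t u : con A).

Definition commutator_compact := forall a b,
  con_compact a -> con_compact b -> con_compact (commutator a b).

(* The value at 0 is only meaningful for b = a, where it is [a, a]^0 = a. *)
Fixpoint commutator_iter a b (n : nat) : con A :=
  match n with
  | 0 => a
  | 1 => commutator a b
  | n'.+1 => commutator (commutator_iter a b n') (commutator_iter a b n')
  end.

Definition condition_star := forall a b, con_compact a -> con_compact b ->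
  forall n, 0 < n -> exists m,
    commutator (commutator_iter a a m) (commutator_iter b b m)
      <=c commutator_iter a b n.

Definition con_perp a := con_sup [set t | commutator a t = 'Delta].

Definition congruence_normal := forall t u, t \/c u = 'Nabla ->
  exists a b, [/\ t \/c a = 'Nabla, u \/c b = 'Nabla & commutator a b = 'Delta].

Definition con_prime t := t <> 'Nabla /\
  forall a b, commutator a b <=c t -> a <=c t \/ b <=c t.

Definition con_pure t := forall a, con_compact a -> a <=c t ->
  t \/c con_perp a = 'Nabla.

Definition Vir t := con_sup [set a | con_pure a /\ a <=c t].

Definition con_purely_prime t := [/\ con_pure t, t <> 'Nabla &
  forall a b, con_pure a -> con_pure b ->
    commutator a b <=c t -> a <=c t \/ b <=c t].

Definition Spec := {p : con A | con_prime p}.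

HB.instance Definition _ := gen_eqMixin Spec.
HB.instance Definition _ := gen_choiceMixin Spec.

Definition zariskiV t : set Spec := [set p | t <=c sval p].
Definition zariskiD t : set Spec := ~` zariskiV t.
Definition zariski_open : set (set Spec) := range zariskiD.

Lemma zariski_openT : zariski_open setT.
Proof.
exists 'Nabla => //; apply/seteqP; split=> // p _.
by apply/con_properP; case: p => p [].
Qed.

Lemma zariski_openI : setI_closed zariski_open.
Proof.
move=> _ _ [a _ <-] [b _ <-]; exists (commutator a b) => //; apply/seteqP; split=> p.
  have /con_meet_le[la lb] := @commutator_le_meet _ _ A a b.
  by move=> h; split=> k; apply: h; apply: con_le_trans k.
by case=> ha hb /(svalP p).2 [].
Qed.

Lemma zariski_open_bigU (I : Type) (f : I -> set Spec) :
  (forall i, zariski_open (f i)) -> zariski_open (\bigcup_i f i).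
Proof.
move=> h.
exists (con_sup [set t | exists i, zariskiD t = f i]) => //.
apply/seteqP; split=> p.
  move=> hp; apply: contrapT => hU; apply: hp; apply: con_sup_le => t [i ti].
  by apply: contrapT => hp; apply: hU; exists i => //; rewrite -ti.
case=> i _ fip hp; have [t _ ti] := h i.
move: fip; rewrite -ti; apply; apply: con_le_trans hp.
by apply: con_sup_ub; exists i.
Qed.

HB.instance Definition _ := isOpenTopological.Build Spec
  zariski_openT zariski_openI zariski_open_bigU.

(* Maximal congruences are prime in a semidegenerate congruence-modular
   variety.  The coercion of this set to a type carries the subspace
   topology. *)
Definition Max : set Spec := [set p | con_maximal (sval p)].

Definition Lambda t : set Spec := [set p | sval p <=c t].

Definition Rad t := con_inf [set sval p | p in Max `&` zariskiV t].

Definition PureSpec := {p : con A | con_purely_prime p}.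

HB.instance Definition _ := gen_eqMixin PureSpec.
HB.instance Definition _ := gen_choiceMixin PureSpec.

Definition pureD t : set PureSpec := [set p | ~ t <=c sval p].

(* When the variety is semidegenerate and congruence-modular, the pure
   congruences form a frame on which the commutator is the intersection: the
   sets [pureD t], t pure, are then closed under unions and finite
   intersections, and the topology they generate has no other open set. *)
HB.instance Definition _ := isSubBaseTopological.Build PureSpec
  [set pureD t | t in con_pure] id.

End Algebra.

Arguments Max {S V} A _.
Arguments Lambda {S V} A t _.

Lemma zariski_openE (S : signature) (V : variety S) (A : member V)
  (U : set (Spec A)) : open U <-> exists t, U = zariskiD t.
Proof. by split=> [[t _ <-]|[t ->]]; exists t. Qed.

Definition homeomorphism (X Y : topologicalType) (f : X -> Y) :=
  continuous f /\
  exists g : Y -> X, [/\ cancel f g, cancel g f & continuous g].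

(* Main.v *)
From Stdlib Require Import Relation_Operators.
Require Import Defs.
From mathcomp Require Import all_boot finmap.
From mathcomp Require Import all_classical.
From mathcomp Require Import topology separation_axioms.

Set Implicit Arguments.
Unset Strict Implicit.
Unset Printing Implicit Defensive.

Local Open Scope classical_set_scope.
Local Open Scope con_scope.

(** All nine conditions are brought back to one separation property: any two
    distinct maximal congruences p and q admit compact s, b with s not below q,
    b not below p and [s, b] = 'Delta ([max_separated]).  It is used through
    two consequences.  First, the join of the compact c whose annihilator is
    not below p is a pure congruence below p and below no other maximal
    congruence ([annihilated_outside_pure], [annihilated_outside_not_le]), so
    the pure parts of distinct maximal congruences are comaximal.  Second, the
    join of the compact b with t \/ b^perp = 'Nabla is a pure congruence below
    t which lies under the same maximal congruences as t, so Vir t <= p forces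
    t <= p for maximal p ([Vir_le_maximal]).  Congruence normality follows: if
    t \/ u = 'Nabla, then Vir t \/ u = 'Nabla, hence s \/ u = 'Nabla for some
    compact s <= Vir t, and s and its annihilator are the required witnesses
    ([normal_of_Vir_le]).

    The topological conditions follow a cycle: normality of the lattice
    separates closed sets; in a normal spectrum every prime lies below exactly
    one maximal congruence, and sending it there is a continuous retraction;
    the fibres of a retraction are the sets Lambda p.  To return from the
    closedness of Lambda p to the separation property, the condition on
    iterated commutators is used to build a prime below p by Zorn's lemma
    ([prime_below_avoiding]).  The homeomorphism with the pure spectrum comes
    from the fact that a purely prime congruence is below a single maximal p
    and then equals Vir p ([purely_prime_eq_Vir]).

    These arguments need the commutator to be commutative and distributive over
    joins, to satisfy ['Nabla, b] = b, and 'Nabla to be compact.  Since the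
    commutator is only given as the greatest operation with two properties, an
    explicit operation is compared with it.  Pairs of b form an algebra, in
    which con_Delta a b is the congruence generated by identifying (x, x) with
    (y, y) whenever a x y.  The explicit commutator [comm] relates x and y when
    con_Delta a b relates (x, z) and (y, z).  Applying the two properties to
    the first projection of this algebra shows that every operation that has
    them is below [comm] ([comm_greatest]); the modular law gives additivity,
    symmetry and the two properties themselves ([comm_sup], [comm_sym],
    [comm_axioms]).  Semidegeneracy enters because the class of the diagonal
    modulo con_Delta 'Nabla b is a one-element subalgebra of a quotient. *)

(** * Generated congruences *)

Section Generation.
Context {S : signature} {A : algebra S}.
Implicit Types (R : A -> A -> Prop) (N : A -> Prop) (a b c t : con A).
Implicit Types (X : set (con A)).

Definition con_gen R : con A :=
  con_inf [set t : con A | forall x y, R x y -> t x y].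

Lemma con_gen_sub R x y : R x y -> con_gen R x y.
Proof. by move=> Rxy t; exact. Qed.

Lemma con_gen_le R t : (forall x y, R x y -> t x y) -> con_gen R <=c t.
Proof. by move=> h x y; exact. Qed.

Definition subst_at n (x : 'I_n -> A) (i : 'I_n) (u : A) : 'I_n -> A :=
  fun j => if j == i then u else x j.

(** The arguments of an operation are exchanged one at a time, from the left. *)
Lemma op_compat_coordinatewise R :
  (forall x, R x x) -> (forall x y z, R x y -> R y z -> R x z) ->
  (forall o x i u v, R u v ->
     R (op A o (subst_at x i u)) (op A o (subst_at x i v))) ->
  forall o x y, (forall i, R (x i) (y i)) -> R (op A o x) (op A o y).
Proof.
move=> Rrefl Rtrans Rsubst o x y xy.
pose mix k : 'I_(arity o) -> A := fun j => if (j < k)%N then y j else x j.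
have step k : (k <= arity o)%N -> R (op A o x) (op A o (mix k)).
  elim: k => [|k IH] hk.
    by rewrite (_ : mix 0 = x) //; apply/funext => j; rewrite /mix ltn0.
  apply: Rtrans (IH (ltnW hk)) _.
  have := Rsubst o (mix k) (Ordinal hk) _ _ (xy (Ordinal hk)).
  congr R; congr op; apply/funext => j; rewrite /subst_at /mix -val_eqE /=.
    by case: (ltngtP j k) => // jk; congr x; exact: val_inj.
  by rewrite ltnS; case: (ltngtP j k) => // jk; congr y; exact: val_inj.
have := step (arity o) (leqnn _).
by rewrite (_ : mix _ = y) //; apply/funext => j; rewrite /mix ltn_ord.
Qed.

(** The reflexive transitive closure of R is already the
    congruence it generates, so invariance can be checked along single steps
    of R. *)
Lemma con_gen_stable_translation R N :
  (forall x y, R x y -> R y x) ->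
  (forall o x i u v, R u v ->
     R (op A o (subst_at x i u)) (op A o (subst_at x i v))) ->
  (forall x y, R x y -> N x -> N y) ->
  forall x y, con_gen R x y -> N x -> N y.
Proof.
move=> Rsym Rsubst RN x y Rxy.
have [t tE] : exists t : con A, forall u v, t u v <-> clos_refl_trans A R u v.
  have h1 u : clos_refl_trans A R u u by exact: rt_refl.
  have h3 u v w : clos_refl_trans A R u v -> clos_refl_trans A R v w ->
    clos_refl_trans A R u w by exact: rt_trans.
  have h2 u v : clos_refl_trans A R u v -> clos_refl_trans A R v u.
    elim=> [u' v' /Rsym|//|u' v' w _ vu _ wv]; first exact: rt_step.
    exact: h3 wv vu.
  have h4 : forall o (x' y' : 'I_(arity o) -> A),
      (forall i, clos_refl_trans A R (x' i) (y' i)) ->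
      clos_refl_trans A R (op A o x') (op A o y').
    apply: op_compat_coordinatewise => // o x' i u v.
    elim=> [u' v' /Rsubst h|//|u' v' w _ uv _ vw]; first exact: rt_step.
    exact: h3 uv vw.
  by exists (Con h1 h2 h3 h4).
have {Rxy} /tE : t x y by apply: Rxy => u v uv; apply/tE; exact: rt_step.
by elim=> [u v /RN|//|u v w _ uv _ vw /uv /vw].
Qed.

Lemma con_gen_stable R N :
  (forall x, R x x) -> (forall x y, R x y -> R y x) ->
  (forall o x y, (forall i, R (x i) (y i)) -> R (op A o x) (op A o y)) ->
  (forall x y, R x y -> N x -> N y) ->
  forall x y, con_gen R x y -> N x -> N y.
Proof.
move=> Rrefl Rsym Rop; apply: con_gen_stable_translation => // o x i u v uv.
by apply: Rop => j; rewrite /subst_at; case: ifP.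
Qed.

Lemma con_sup_stable X N :
  (forall a, X a -> forall x y, a x y -> N x -> N y) ->
  forall x y, con_sup X x y -> N x -> N y.
Proof.
move=> XN x y sxy.
pose R x y := exists2 a : con A, X a & a x y.
apply: (@con_gen_stable_translation R).
- by move=> u v [a Xa auv]; exists a => //; exact: con_sym.
- move=> o z i u v [a Xa auv]; exists a => //; apply: con_op => j.
  by rewrite /subst_at; case: ifP => // _; exact: con_refl.
- by move=> u v [a Xa]; exact: XN.
- by apply: sxy => a Xa u v auv; apply: con_gen_sub; exists a.
Qed.

Lemma con_join_stable a b N :
  (forall x y, a x y -> N x -> N y) -> (forall x y, b x y -> N x -> N y) ->
  forall x y, (a \/c b) x y -> N x -> N y.
Proof. by move=> aN bN; apply: con_sup_stable => _ [] ->. Qed.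

Lemma con_bot_le a : 'Delta <=c a.
Proof. by move=> x y /= ->; exact: con_refl. Qed.

Lemma con_join_mono a b c t : a <=c c -> b <=c t -> a \/c b <=c c \/c t.
Proof.
move=> ac bt; apply: con_join_le.
  by apply: con_le_trans ac _; exact: con_joinl.
by apply: con_le_trans bt _; exact: con_joinr.
Qed.

Lemma con_joinC a b : a \/c b = b \/c a.
Proof.
by apply: con_le_anti; apply: con_join_le; (exact: con_joinl || exact: con_joinr).
Qed.

Lemma con_joinT_mono a b c t : a <=c c -> b <=c t -> a \/c b = 'Nabla ->
  c \/c t = 'Nabla.
Proof.
move=> ac bt e; apply: con_le_anti => //; rewrite -e; exact: con_join_mono.
Qed.

Lemma con_sup_mono X (Y : set (con A)) : X `<=` Y -> con_sup X <=c con_sup Y.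
Proof. by move=> XY; apply: con_sup_le => a /XY; exact: con_sup_ub. Qed.

End Generation.

(** * Images, preimages and quotients *)

Definition con_pull (S : signature) (A B : algebra S) (f : A -> B)
  (hf : is_hom f) (t : con B) : con A.
Proof.
exists (fun x y => t (f x) (f y)).
- by move=> x; exact: con_refl.
- by move=> x y; exact: con_sym.
- by move=> x y z; exact: con_trans.
- by move=> o x y h; rewrite !hf; exact: con_op.
Defined.

Section Images.
Context {S : signature} {A B : algebra S} (f : epi A B).
Implicit Types (a t : con A) (u : con B).

Lemma con_image_le a u : a <=c con_preim f u -> con_image f a <=c u.
Proof.
move=> h v w [x [y [<- <- k]]].
apply: (con_join_le h _ k) => x' y' /= kxy.
by rewrite /= (kxy : f x' = f y'); exact: con_refl.
Qed.

Lemma con_image_mem a x y : a x y -> con_image f a (f x) (f y).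
Proof. by move=> axy; exists x, y; split=> //; exact: con_joinl. Qed.

Lemma con_image_memP a x y : con_image f a (f x) (f y) <-> (a \/c con_ker f) x y.
Proof.
split=> [[x' [y' [fx fy h]]]|h]; last by exists x, y.
have k : con_ker f <=c a \/c con_ker f by exact: con_joinr.
by apply: (con_trans (k x x' _)); [|apply: (con_trans h (k y' y _))].
Qed.

End Images.

Section Quotient.
Context {S : signature} {A : algebra S} (t : con A).

(** The classes of t, as predicates. *)
Definition quot_carrier := {P : A -> Prop | exists x, P = t x}.

Definition quot_class (x : A) : quot_carrier := exist _ (t x) (ex_intro _ x erefl).

Definition quot_repr (P : quot_carrier) : A := projT1 (cid (svalP P)).

Lemma quot_carrier_inj (P Q : quot_carrier) : sval P = sval Q -> P = Q.
Proof. by case: P Q => P hP [Q hQ] /=; exact: eq_exist. Qed.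

Lemma quot_reprK : cancel quot_repr quot_class.
Proof.
move=> P; apply: quot_carrier_inj; rewrite /quot_repr /=.
by case: (cid (svalP P)) => x /= ->.
Qed.

Lemma quot_classP x y : quot_class x = quot_class y <-> t x y.
Proof.
split=> [/(congr1 sval)/= e|xy]; first by rewrite e; exact: con_refl.
apply: quot_carrier_inj; apply/funext => z; apply/propext; split=> h.
  by apply: con_trans h; exact: con_sym.
exact: con_trans h.
Qed.

Lemma quot_inhabited : inhabited quot_carrier.
Proof. by have [x] := carrier_inhabited A; exists; exact: quot_class x. Qed.

Definition quot_algebra : algebra S :=
  @Algebra S quot_carrier (fun o x => quot_class (op A o (quot_repr \o x)))
    quot_inhabited.

Lemma quot_class_hom : is_hom (quot_class : A -> quot_algebra).
Proof.
move=> o x; apply/quot_classP; apply: con_op => i /=.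
by apply/quot_classP; rewrite quot_reprK.
Qed.

Lemma quot_class_surj (P : quot_algebra) : exists x, quot_class x = P.
Proof. by exists (quot_repr P); exact: quot_reprK. Qed.

End Quotient.

(** Semidegeneracy is applied to the quotient by t, in which the class of c is
    a one-element subalgebra. *)
Lemma semidegenerate_top (S : signature) (V : variety S) :
  semidegenerate V -> forall (A : member V) (t : con A) (c : A),
  (forall o, t (op A o (fun=> c)) c) -> t = 'Nabla.
Proof.
move=> hsd A t c tc.
pose Q := Member (variety_H (@quot_class_hom _ _ t) (@quot_class_surj _ _ t)
  (member_mem A)).
apply: con_le_anti => // x y _; apply: contrapT => txy.
apply: (hsd Q).
  by exists (quot_class t x), (quot_class t y) => /quot_classP.
exists (quot_class t c) => o.
apply: etrans (esym (@quot_class_hom _ _ t o (fun=> c))) _.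
exact/quot_classP.
Qed.

(** * A congruence as an algebra of pairs *)

Section PairAlgebra.
Context {S : signature} {A : algebra S}.
Implicit Types (a b t : con A).

Definition pair_carrier b := {p : A * A | b p.1 p.2}.

Definition pair_mk b x y (h : b x y) : pair_carrier b := exist _ (x, y) h.

Lemma pair_eq b (p q : pair_carrier b) :
  (sval p).1 = (sval q).1 -> (sval p).2 = (sval q).2 -> p = q.
Proof.
case: p q => [[x y] p] [[z w] q] /= xz yw; subst z w.
by congr exist; exact: Prop_irrelevance.
Qed.

Lemma pair_inhabited b : inhabited (pair_carrier b).
Proof. by have [x] := carrier_inhabited A; exists; exact: pair_mk (con_refl b x). Qed.

Definition pair_algebra b : algebra S :=
  @Algebra S (pair_carrier b)
    (fun o p => pair_mk (con_op (fun i => svalP (p i)))) (pair_inhabited b).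

Definition diag b (x : A) : pair_algebra b := pair_mk (con_refl b x).

Definition swap b (p : pair_algebra b) : pair_algebra b :=
  pair_mk (con_sym (svalP p)).

Lemma diag_hom b : is_hom (diag b).
Proof. by move=> o x; exact: pair_eq. Qed.

Lemma swap_hom b : is_hom (@swap b).
Proof. by move=> o x; exact: pair_eq. Qed.

Definition pair_fst b : epi (pair_algebra b) A.
Proof.
exists (fun p => (sval p).1); first by [].
by move=> x; exists (diag b x).
Defined.

Definition pair_snd b : epi (pair_algebra b) A.
Proof.
exists (fun p => (sval p).2); first by [].
by move=> x; exists (diag b x).
Defined.

(** With ((x, z), (y, w)) in this congruence written as a 2 x 2 matrix, z is
    related to x, and w to y, by b, while y is related to x, and w to z, by a:
    it is the congruence Delta_{a,b} of modular commutator theory. *)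
Definition con_Delta a b : con (pair_algebra b) :=
  con_gen (fun p q => exists x y, [/\ a x y, p = diag b x & q = diag b y]).

Lemma con_Delta_mem a b x y : a x y -> con_Delta a b (diag b x) (diag b y).
Proof. by move=> axy; apply: con_gen_sub; exists x, y. Qed.

Lemma con_Delta_le a b (t : con (pair_algebra b)) :
  (forall x y, a x y -> t (diag b x) (diag b y)) -> con_Delta a b <=c t.
Proof. by move=> h; apply: con_gen_le => _ _ [x [y [/h ? -> ->]]]. Qed.

Lemma con_Delta_swap a b p q :
  con_Delta a b p q -> con_Delta a b (swap p) (swap q).
Proof.
apply: (con_Delta_le (t := con_pull (@swap_hom b) (con_Delta a b))) => x y axy.
have e z : swap (diag b z) = diag b z by exact: pair_eq.
by rewrite /= !e; exact: con_Delta_mem.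
Qed.

Lemma con_Delta_le_fst a b : con_Delta a b <=c con_preim (pair_fst b) a.
Proof. exact: con_Delta_le. Qed.

End PairAlgebra.

Lemma pair_mem (S : signature) (V : variety S) (A : member V) (b : con A) :
  variety_mem V (pair_algebra b).
Proof.
pose f (p : pair_algebra b) : prod_algebra (fun _ : bool => A : algebra S) :=
  fun i => if i then (sval p).1 else (sval p).2.
apply: (variety_S (f := f)).
- by move=> o x; apply: functional_extensionality_dep => -[].
- move=> p q e; apply: pair_eq.
    exact: (congr1 (fun g => g true) e).
  exact: (congr1 (fun g => g false) e).
- by apply: variety_P => _; exact: member_mem.
Qed.

Definition pair_member (S : signature) (V : variety S) (A : member V)
  (b : con A) : member V := Member (pair_mem b).

(** * The commutator of a congruence-modular variety *)

Section Modular.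
Context {S : signature} {V : variety S} (hmod : congruence_modular V).

Lemma modular_mem (A : member V) (a b t : con A) x y : a <=c t ->
  (a \/c b) x y -> t x y -> (a \/c (b /\c t)) x y.
Proof.
move=> at_ abxy txy; rewrite -(hmod b at_).
by move=> _ [] ->.
Qed.

Section Pairs.
Context {A : member V}.
Implicit Types (a b d : con A).

(** The Shifting Lemma in the lattice of congruences of the pairs: moving the
    pair p, q along the kernel of the second projection does not leave t, by
    the modular law applied to t /\ e1, e2 and e1, where the kernels e1 and e2
    meet in 'Delta. *)
Lemma pair_shift b (t : con (pair_member b)) (p q p' q' : pair_member b) :
  t p q -> (sval p).1 = (sval q).1 -> (sval p').1 = (sval q').1 ->
  (sval p').2 = (sval p).2 -> (sval q').2 = (sval q).2 -> t p' q'.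
Proof.
move=> tpq pq1 pq1' pp' qq'.
pose e1 := con_ker (pair_fst b : epi (pair_member b) A).
pose e2 := con_ker (pair_snd b : epi (pair_member b) A).
have tp'q' : ((t /\c e1) \/c e2) p' q'.
  apply: (@con_trans _ _ _ p' p); first exact: con_joinr.
  apply: (@con_trans _ _ _ p q); last by apply: con_joinr; exact: esym.
  by apply: con_joinl => _ [] ->.
have le1 : t /\c e1 <=c e1 by move=> u v h; apply: h; right.
have := modular_mem (A := pair_member b) le1 tp'q' pq1'.
apply: (con_join_le (t := t)) => u v h; first by apply: h; left.
have uv1 : (sval u).1 = (sval v).1 := h e1 (or_intror erefl).
have uv2 : (sval u).2 = (sval v).2 := h e2 (or_introl erefl).
by rewrite (pair_eq uv1 uv2); exact: con_refl.
Qed.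

(** The explicit commutator: x and y are related when con_Delta a b relates
    (x, z) to (y, z) for some z; taking the image of a meet makes this a
    congruence at once. *)
Definition comm a b : con A :=
  con_image (pair_fst b)
    (con_Delta a b /\c con_ker (pair_snd b) : con (pair_member b)).

(** The choice of z does not matter: by the modular law, con_Delta a b and the
    preimage of comm a b have the same meet with the kernel of the second
    projection. *)
Lemma comm_fst a b (p q : pair_member b) : (sval p).2 = (sval q).2 ->
  comm a b (sval p).1 (sval q).1 <-> con_Delta a b p q.
Proof.
move=> pq2; split=> [|pq].
  move/(con_image_memP (pair_fst b : epi (pair_member b) A)).
  move=> h.
  have le2 : con_Delta a b /\c con_ker (pair_snd b) <=c
     (con_ker (pair_snd b) : con (pair_member b)).
    by move=> u v k; apply: k; right.
  have := modular_mem (A := pair_member b) le2 h pq2.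
  apply: con_join_le => u v k; first by apply: k; left.
  have uv1 : (sval u).1 = (sval v).1 := k _ (or_introl erefl).
  have uv2 : (sval u).2 = (sval v).2 := k _ (or_intror erefl).
  by rewrite (pair_eq uv1 uv2); exact: con_refl.
apply: (con_image_mem (pair_fst b : epi (pair_member b) A)).
by move=> _ [] ->.
Qed.

Lemma comm_snd a b (p q : pair_member b) : (sval p).1 = (sval q).1 ->
  comm a b (sval p).2 (sval q).2 <-> con_Delta a b p q.
Proof.
move=> pq1; split=> [h|/con_Delta_swap h].
  have /con_Delta_swap := (comm_fst a (p := swap p) (q := swap q) pq1).1 h.
  have swapK (r : pair_member b) : swap (swap r) = r by exact: pair_eq.
  by rewrite !swapK.
exact: ((comm_fst a (p := swap p) (q := swap q) pq1).2 h).
Qed.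

Lemma comm_lel a b : comm a b <=c a.
Proof.
apply: con_image_le => p q h; apply: con_Delta_le_fst.
by apply: h; left.
Qed.

Lemma comm_ler a b : comm a b <=c b.
Proof.
apply: con_image_le => p q h.
have pq2 : (sval p).2 = (sval q).2 := h _ (or_intror erefl).
apply: (con_trans (svalP p)); rewrite pq2; apply: con_sym; exact: (svalP q).
Qed.

Lemma commP a b x y (h : b x y) :
  comm a b x y <-> con_Delta a b (pair_mk h) (diag b y).
Proof. exact: (comm_fst a (p := pair_mk h) (q := diag b y)). Qed.

(** This is the term condition: a centralizes b modulo every d above the
    commutator. *)
Lemma con_Delta_stable a b d : comm a b <=c d ->
  forall p q, con_Delta a b p q ->
    d (sval p).1 (sval p).2 -> d (sval q).1 (sval q).2.
Proof.
move=> cd p q pq dp.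
pose e1 := con_ker (pair_fst b : epi (pair_member b) A).
pose d2 := con_preim (pair_snd b : epi (pair_member b) A) d.
(* (y, y) reaches q = (y, w) through (x, x) and p = (x, z), where x d z; all of
   this path but its middle part lies in con_Delta a b. *)
pose s := diag b (sval q).1.
have h : ((d2 /\c e1) \/c con_Delta a b) s q.
  apply: (@con_trans _ _ _ _ (diag b (sval p).1)).
    apply: con_joinr; apply: con_Delta_mem; apply: con_sym.
    exact: con_Delta_le_fst pq.
  apply: (@con_trans _ _ _ _ p); last exact: con_joinr.
  by apply: con_joinl => _ [] ->.
have le1 : d2 /\c e1 <=c e1 by move=> u v k; apply: k; right.
have := modular_mem (A := pair_member b) le1 h (erefl : e1 s q).
apply: (con_join_le (t := d2)) => u v k; first by apply: k; left.
apply: cd; apply: (comm_snd _ _).2; first exact: (k e1 (or_intror erefl)).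
by apply: k; left.
Qed.

(** The pairs of d are invariant under each con_Delta a b, hence under their
    join, which is con_Delta (con_sup X) b. *)
Lemma comm_sup (X : set (con A)) b :
  comm (con_sup X) b <=c con_sup [set comm a b | a in X].
Proof.
set d := con_sup [set _ | _ in _].
move=> x y xy; have bxy := comm_ler xy.
move/commP : xy => /(_ bxy) xy.
suff : con_sup [set con_Delta a b | a in X] (diag b y) (pair_mk bxy).
  have N t : [set con_Delta a b | a in X] t -> forall p q, t p q ->
      d (sval p).1 (sval p).2 -> d (sval q).1 (sval q).2.
    move=> [a Xa <-]; apply: con_Delta_stable.
    by apply: con_sup_ub; exists a.
  by move/(con_sup_stable N); apply; exact: con_refl.
apply: con_sym; move: xy; apply: con_Delta_le.
pose T := con_sup [set con_Delta a b | a in X].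
apply: (con_sup_le (t := con_pull (@diag_hom _ _ b) T)) => a Xa u v auv /=.
apply: con_sup_ub; [by exists a|exact: con_Delta_mem].
Qed.

(** Transposing the matrices of con_Delta a b gives a compatible relation R on
    the pairs of a which contains the generators of con_Delta b a.  So it is
    enough that R preserves the pairs of d, which is the term condition read
    along the other side of a matrix; the Shifting Lemma provides it. *)
Lemma comm_sym_le a b : comm b a <=c comm a b.
Proof.
set d := comm a b => x y xy; have axy := comm_ler xy.
move/commP : xy => /(_ axy) xy.
pose R (p q : pair_algebra a) := exists r s : pair_algebra b,
  [/\ sval r = ((sval p).1, (sval q).1), sval s = ((sval p).2, (sval q).2)
    & con_Delta a b r s].
suff : forall p q, con_gen R p q ->
    d (sval p).1 (sval p).2 -> d (sval q).1 (sval q).2.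
  move=> N; apply: (N (diag a y) (pair_mk axy)); last exact: con_refl.
  apply: con_sym; move: xy; apply: con_Delta_le => u v buv.
  apply: con_gen_sub; exists (pair_mk buv), (pair_mk buv); split=> //.
  exact: con_refl.
apply: con_gen_stable.
- move=> p; exists (diag b (sval p).1), (diag b (sval p).2); split=> //.
  by apply: con_Delta_mem; exact: (svalP p).
- move=> p q [r [s [rE sE rs]]]; exists (swap r), (swap s).
  by split; [rewrite /= rE|rewrite /= sE|exact: con_Delta_swap].
- move=> o p q /choice[r /choice[s rs]].
  exists (op (pair_algebra b) o r), (op (pair_algebra b) o s); split.
  + by congr pair; congr (op A o); apply/funext => i; have [-> _ _] := rs i.
  + by congr pair; congr (op A o); apply/funext => i; have [_ -> _] := rs i.
  + by apply: con_op => i; have [] := rs i.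
- move=> p q [r [s [rE sE rs]]] dp.
  (* Modulo d on both coordinates, r = (x, z) may be replaced by (y, z), which
     has the same first coordinate as s = (y, w); shifting to (z, z) and (z, w)
     gives z d w. *)
  pose d12 := con_preim (pair_fst b : epi (pair_member b) A) d
    /\c con_preim (pair_snd b : epi (pair_member b) A) d.
  pose T := con_Delta a b \/c d12.
  have N : forall u v, T u v ->
      d (sval u).1 (sval u).2 -> d (sval v).1 (sval v).2.
    apply: con_join_stable; first exact: con_Delta_stable.
    move=> u v h du.
    have h1 : d (sval u).1 (sval v).1 := h _ (or_introl erefl).
    have h2 : d (sval u).2 (sval v).2 := h _ (or_intror erefl).
    by apply: (con_trans (con_sym h1)); apply: con_trans h2.
  have br : b (sval p).1 (sval q).1 by have := svalP r; rewrite rE.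
  have bs : b (sval p).2 (sval q).2 by have := svalP s; rewrite sE.
  have br' : b (sval p).2 (sval q).1.
    by apply: con_trans br; apply: con_sym; exact: comm_ler dp.
  have bq : b (sval q).1 (sval q).2 by apply: con_trans (con_sym br') bs.
  apply: (N (diag b (sval q).1) (pair_mk bq)); last exact: con_refl.
  apply: (pair_shift (t := T) (p := pair_mk br') (q := s)); rewrite ?sE //.
  apply: (@con_trans _ _ _ _ r); last exact: con_joinl.
  apply: con_joinr => _ [] ->.
    by change (d (sval p).2 (sval r).1); rewrite rE; exact: con_sym.
  by change (d (sval q).1 (sval r).2); rewrite rE; exact: con_refl.
Qed.

Lemma comm_sym a b : comm a b = comm b a.
Proof. by apply: con_le_anti; exact: comm_sym_le. Qed.

Lemma comm_joinl a b c : comm (a \/c b) c <=c comm a c \/c comm b c.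
Proof.
apply: con_le_trans (@comm_sup _ _) _; apply: con_sup_le => _ [t tab <-].
by case: tab => ->; [exact: con_joinl|exact: con_joinr].
Qed.

End Pairs.

(** For the homomorphism property, additivity allows a and b to be replaced by
    their joins with the kernel k; the pairs of a \/ k and b \/ k then map onto
    those of the images, con_Delta onto con_Delta, and invariance of the pairs
    of comm a b \/ k is transported along this surjection. *)
Lemma comm_axioms : commutator_axioms (V := V) (@comm).
Proof.
split=> [A a b|A B f a b].
  by apply/con_meet_le; split; [exact: comm_lel|exact: comm_ler].
set k := con_ker f; set fa := con_image f a; set fb := con_image f b.
apply: con_le_anti.
  apply: con_join_le => [x y xy|x y fxy]; last first.
    change (comm fa fb (f x) (f y)).
    by rewrite (fxy : f x = f y); exact: con_refl.
  have bxy := comm_ler xy; move/commP : xy => /(_ bxy) xy.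
  pose g (p : pair_algebra b) : pair_algebra fb :=
    pair_mk (con_image_mem f (svalP p)).
  have hg : is_hom g by move=> o p; apply: pair_eq; rewrite /= epi_hom.
  have : con_pull hg (con_Delta fa fb) (pair_mk bxy) (diag b y).
    apply: con_Delta_le xy => u v auv.
    change (con_Delta fa fb (g (diag b u)) (g (diag b v))).
    have e z : g (diag b z) = diag fb (f z) by exact: pair_eq.
    by rewrite !e; apply: con_Delta_mem; exact: con_image_mem.
  by move/(comm_fst fa (p := g (pair_mk bxy)) (q := g (diag b y)) erefl).
set a' := a \/c k; set b' := b \/c k; set d := comm a' b' \/c k.
have dE : d <=c comm a b \/c k.
  apply: con_join_le; last exact: con_joinr.
  apply: con_le_trans (@comm_joinl _ _ _ _) _.
  apply: con_join_le; last first.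
    by apply: con_le_trans (@comm_lel _ _ _) _; exact: con_joinr.
  rewrite comm_sym; apply: con_le_trans (@comm_joinl _ _ _ _) _.
  apply: con_join_mono; first by rewrite comm_sym.
  exact: comm_lel.
move=> x y xy; apply: dE.
have bxy : b' x y by apply/con_image_memP; exact: comm_ler xy.
pose g (p : pair_member b') : pair_member fb :=
  pair_mk ((con_image_memP f b _ _).2 (svalP p)).
have hg : is_hom g by move=> o p; apply: pair_eq; rewrite /= epi_hom.
have sg q : exists p, g p = q.
  have [u [v [ufst vsnd uv]]] := svalP q.
  by exists (pair_mk (uv : b' u v)); exact: pair_eq.
pose ge := Epi hg sg.
have : con_image ge (con_Delta a' b') (g (pair_mk bxy)) (g (diag b' y)).
  have := (comm_fst fa (p := g (pair_mk bxy)) (q := g (diag b' y)) erefl).1 xy.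
  apply: con_Delta_le => _ _ [u [v [<- <- uv]]].
  have e z : diag fb (f z) = g (diag b' z) by exact: pair_eq.
  rewrite !e; apply: (con_image_mem ge); exact: con_Delta_mem.
move/(con_image_memP ge)/con_sym => h.
have N : forall p q, (con_Delta a' b' \/c con_ker ge) p q ->
    d (sval p).1 (sval p).2 -> d (sval q).1 (sval q).2.
  apply: con_join_stable => p q.
    by apply: con_Delta_stable; exact: con_joinl.
  have kd : k <=c d by exact: con_joinr.
  move=> /(congr1 sval)[h1 h2] dp.
  apply: (@con_trans _ _ _ _ (sval p).1); first exact: (kd _ _ (esym h1)).
  by apply: con_trans dp _; exact: (kd _ _ h2).
by apply: (N _ _ h); exact: con_refl.
Qed.

(** D is applied in the algebra of pairs to con_Delta a b and to the kernel of
    the second projection, whose images under the first projection are a and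
    b. *)
Lemma comm_greatest (D : con_operation V) : commutator_axioms D ->
  forall (A : member V) (a b : con A), D A a b <=c comm a b.
Proof.
move=> [Dmeet Dhom] A a b x y Dxy.
pose f1 := pair_fst b : epi (pair_member b) A.
pose f2 := pair_snd b : epi (pair_member b) A.
pose d := con_Delta a b : con (pair_member b).
have ad : con_image f1 d = a.
  apply: con_le_anti => [|u v auv].
    by apply: con_image_le; exact: con_Delta_le_fst.
  by apply: (con_image_mem f1 (x := diag b u) (y := diag b v));
    exact: con_Delta_mem.
have be : con_image f1 (con_ker f2) = b.
  apply: con_le_anti => [|u v buv].
    apply: con_image_le => p q pq.
    apply: (con_trans (svalP p)); rewrite [(sval p).2]pq; apply: con_sym.
    exact: (svalP q).
  exact: (con_image_mem f1 (x := pair_mk buv) (y := diag b v)).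
have e := Dhom _ _ f1 d (con_ker f2).
rewrite ad be in e.
have : con_preim f1 (D A a b) (diag b x) (diag b y) by [].
rewrite -e => h.
exists (diag b x), (diag b y); split=> //.
by move: h; apply: con_join_mono => //; exact: Dmeet.
Qed.

Lemma commutatorE (A : member V) (a b : con A) : commutator a b = comm a b.
Proof.
apply: con_le_anti; first by apply: comm_greatest; exact: commutatorP.
exact: (commutator_greatest comm_axioms).
Qed.

End Modular.

(** * Compact congruences *)

Section Compact.
Context {S : signature} {A : algebra S}.
Implicit Types (a b c t u : con A) (X Y : set (con A)) (Q : con A -> Prop).

(** The pairs lying in the join of a finite part of X form a congruence, since
    operations have finite arity. *)
Lemma con_sup_finite_part X x y : con_sup X x y ->
  exists Y, [/\ finite_set Y, Y `<=` X & con_sup Y x y].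
Proof.
pose R x y := exists Y, [/\ finite_set Y, Y `<=` X & con_sup Y x y].
have R1 (u : A) : R u u.
  by exists set0; split=> //; exact: con_refl.
have R2 (u v : A) : R u v -> R v u.
  by move=> [Y [? ? ?]]; exists Y; split=> //; exact: con_sym.
have R3 (u v w : A) : R u v -> R v w -> R u w.
  move=> [Y [fY YX uv]] [Z [fZ ZX vw]]; exists (Y `|` Z); split.
  - by rewrite finite_setU.
  - by rewrite subUset.
  - apply: con_trans (con_sup_mono (@subsetUl _ Y Z) uv) _.
    exact: con_sup_mono (@subsetUr _ Y Z) _ _ vw.
have R4 o (u v : 'I_(arity o) -> A) : (forall i, R (u i) (v i)) ->
    R (op A o u) (op A o v).
  move=> /choice[Y YP]; exists (\bigcup_i Y i); split.
  - by apply: bigcup_finite => // i _; have [] := YP i.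
  - by apply: bigcup_sub => i _; have [] := YP i.
  - apply: con_op => i; have [_ _] := YP i.
    exact: (con_sup_mono (bigcup_sup (F := Y) (I : setT i))).
pose t := Con R1 R2 R3 R4.
move=> sxy; apply: (sxy t) => a Xa u v auv.
by exists [set a]; split=> // [_ -> //|]; exact: (con_sup_ub (X := [set a])).
Qed.

Lemma con_sup_finite_ind Q Y : Q 'Delta ->
  (forall a b, Q a -> Q b -> Q (a \/c b)) -> (forall a b, a <=c b -> Q b -> Q a) ->
  finite_set Y -> (forall a, Y a -> Q a) -> Q (con_sup Y).
Proof.
move=> Q0 QU Qle fY.
have /finite_seqP[s ->] : finite_set (Y : set {classic (con A)}) by [].
elim: s => [|a s IH] hs.
  by apply: Qle Q0; exact: con_sup_le.
have Qa : Q a by apply: hs; rewrite /= mem_head.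
have Qs : Q (con_sup [set` s]).
  by apply: IH => b bs; apply: hs; rewrite /= inE; apply/orP; right.
apply: Qle (QU _ _ Qa Qs); apply: con_sup_le => b.
rewrite /= inE => /orP[/eqP ->|bs]; first exact: con_joinl.
by apply: con_le_trans (@con_joinr _ _ _ _); exact: con_sup_ub.
Qed.

Definition con_pair x y : con A := con_gen (fun z w => z = x /\ w = y).

Lemma con_pair_le x y t : con_pair x y <=c t <-> t x y.
Proof.
split=> [h|h]; first by apply: h; exact: con_gen_sub.
by apply: con_gen_le => _ _ [-> ->].
Qed.

Lemma compact_pair x y : con_compact (con_pair x y).
Proof.
move=> X /con_pair_le /con_sup_finite_part[Y [fY YX h]].
by exists Y; split=> //; exact/con_pair_le.
Qed.

Lemma not_leP t u : ~ t <=c u -> exists c, [/\ con_compact c, c <=c t & ~ c <=c u].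
Proof.
move=> tu; apply: contrapT => h; apply: tu => x y txy; apply: contrapT => uxy.
apply: h; exists (con_pair x y).
by split; [exact: compact_pair|exact/con_pair_le|move/con_pair_le].
Qed.

Lemma compact_bot : con_compact ('Delta : con A).
Proof. by move=> X _; exists set0; split=> //; exact: con_bot_le. Qed.

Lemma compact_join a b : con_compact a -> con_compact b -> con_compact (a \/c b).
Proof.
move=> ca cb X abX.
have [|Y [fY YX aY]] := ca X.
  by apply: con_le_trans abX; exact: con_joinl.
have [|Z [fZ ZX bZ]] := cb X.
  by apply: con_le_trans abX; exact: con_joinr.
exists (Y `|` Z); split; [by rewrite finite_setU|by rewrite subUset|].
apply: con_join_le.
  by apply: con_le_trans aY _; exact: con_sup_mono (@subsetUl _ _ _).
by apply: con_le_trans bZ _; exact: con_sup_mono (@subsetUr _ _ _).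
Qed.

(** For a property inherited by smaller congruences and binary joins, it
    suffices to treat the compact congruences below single members of X. *)
Lemma compact_sup_ind Q X a : Q 'Delta ->
  (forall b c, Q b -> Q c -> Q (b \/c c)) -> (forall b c, b <=c c -> Q c -> Q b) ->
  (forall t c, X t -> con_compact c -> c <=c t -> Q c) ->
  con_compact a -> a <=c con_sup X -> Q a.
Proof.
move=> Q0 QU Qle QX ca aX.
pose Z := [set c | con_compact c /\ exists2 t, X t & c <=c t].
have [|Y [fY YZ aY]] := ca Z.
  apply: con_le_trans aX _; apply: con_sup_le => t Xt x y txy.
  apply: (con_sup_ub (X := Z) (a := con_pair x y)).
    by split; [exact: compact_pair|exists t => //; exact/con_pair_le].
  exact: con_gen_sub.
apply: (Qle _ _ aY); apply: (con_sup_finite_ind Q0 QU Qle fY) => c /YZ[cc [t Xt ct]].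
exact: QX ct.
Qed.

Lemma compact_le_join a t u : con_compact a -> a <=c t \/c u ->
  exists c, [/\ con_compact c, c <=c u & a <=c t \/c c].
Proof.
apply: (compact_sup_ind
  (Q := fun a => exists c, [/\ con_compact c, c <=c u & a <=c t \/c c])).
- by exists 'Delta; split; [exact: compact_bot|exact: con_bot_le|exact: con_bot_le].
- move=> b c [b' [? ? bb']] [c' [? ? cc']]; exists (b' \/c c'); split.
  + exact: compact_join.
  + exact: con_join_le.
  + apply: con_join_le.
      by apply: con_le_trans bb' _; apply: con_join_mono => //; exact: con_joinl.
    by apply: con_le_trans cc' _; apply: con_join_mono => //; exact: con_joinr.
- by move=> b c bc [d [? ? cd]]; exists d; split=> //; exact: con_le_trans cd.
- move=> _ c [] -> cc; last by move=> cu; exists c; split=> //; exact: con_joinr.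
  move=> ct; exists 'Delta; split; [exact: compact_bot|exact: con_bot_le|].
  by apply: con_le_trans ct _; exact: con_joinl.
Qed.

Lemma compact_le_chain X a : X !=set0 -> total_on X con_le ->
  con_compact a -> a <=c con_sup X -> exists2 t, X t & a <=c t.
Proof.
move=> [t0 Xt0] totX.
apply: (compact_sup_ind (Q := fun a => exists2 t, X t & a <=c t)).
- by exists t0 => //; exact: con_bot_le.
- move=> b c [t Xt bt] [u Xu cu]; have [tu|ut] := totX _ _ Xt Xu.
    by exists u => //; apply: con_join_le => //; exact: con_le_trans tu.
  by exists t => //; apply: con_join_le => //; exact: con_le_trans ut.
- by move=> b c bc [t Xt ct]; exists t => //; exact: con_le_trans ct.
- by move=> t c Xt _ ct; exists t.
Qed.

(** Zorn's lemma applies because a compact congruence below the join of a chain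
    is below a member of the chain. *)
Lemma maximal_avoiding (F : set (con A)) t : F `<=` con_compact ->
  (forall c, F c -> ~ c <=c t) ->
  exists m, [/\ t <=c m, forall c, F c -> ~ c <=c m &
    forall a, m <=c a -> a <> m -> exists2 c, F c & c <=c a].
Proof.
move=> Fc Ft.
pose P u := t <=c u /\ forall c, F c -> ~ c <=c u.
pose T := {u | P u}.
pose R (u v : T) := `[< sval u <=c sval v >].
have [|||X totX|[m [tm Fm]] mmax] := @Zorn T R.
- by move=> u; apply/asboolP.
- by move=> u v w /asboolP uv /asboolP vw; apply/asboolP; exact: con_le_trans vw.
- move=> [u hu] [v hv] /asboolP /= uv /asboolP /= vu.
  by apply: eq_exist; exact: con_le_anti.
- have [[u0 Xu0]|X0] := pselect (X !=set0); last first.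
    exists (exist P t (conj (fun _ _ h => h) Ft)) => u Xu.
    by case: X0; exists u.
  pose X' := [set sval u | u in X].
  have hX' : t <=c con_sup X' /\ forall c, F c -> ~ c <=c con_sup X'.
    split.
      apply: con_le_trans (svalP u0).1 _.
      by apply: con_sup_ub; exists u0.
    have totX' : total_on X' con_le.
      move=> _ _ [u Xu <-] [v Xv <-].
      by have [/asboolP|/asboolP] := totX _ _ Xu Xv; [left|right].
    move=> c Fc' cX.
    have [|_ [u Xu <-] cu] := compact_le_chain _ totX' (Fc _ Fc') cX.
      by exists (sval u0), u0.
    exact: ((svalP u).2 _ Fc' cu).
  exists (exist P _ hX') => u Xu; apply/asboolP => /=.
  by apply: con_sup_ub; exists u.
- exists m; split=> // a ma am; apply: contrapT => h; apply: am.
  have ha : t <=c a /\ forall c, F c -> ~ c <=c a.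
    split; first exact: con_le_trans ma.
    by move=> c Fc' ca; apply: h; exists c.
  by have /(congr1 sval) := mmax (exist P a ha) (introT (asboolP _) ma).
Qed.

End Compact.

(** For a fixed c, semidegeneracy says that the pairs (o(c, ..., c), c) generate
    'Nabla, and there are finitely many of them because the signature is
    finite. *)
Lemma compact_top (S : signature) (V : variety S) : semidegenerate V ->
  forall A : member V, con_compact ('Nabla : con A).
Proof.
move=> hsd A X topX; have [c] := carrier_inhabited A.
have /choice[Y YP] : forall o, exists Y,
    [/\ finite_set Y, Y `<=` X & con_sup Y (op A o (fun=> c)) c].
  by move=> o; apply: con_sup_finite_part; exact: topX.
exists (\bigcup_o Y o); split.
- by apply: bigcup_finite => // o _; have [] := YP o.
- by apply: bigcup_sub => o _; have [] := YP o.
- rewrite (@semidegenerate_top _ _ hsd _ (con_sup (\bigcup_o Y o)) c) // => o.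
  have [_ _] := YP o.
  exact: (con_sup_mono (bigcup_sup (F := Y) (I : setT o))).
Qed.

(** * The commutator as a multiplication on congruences *)

Section Multiplication.
Context {S : signature} {V : variety S}.
Context (hmod : congruence_modular V) (hsd : semidegenerate V) {A : member V}.
Implicit Types (a b c p q r t u : con A) (X : set (con A)).

Lemma commutatorC a b : commutator a b = commutator b a.
Proof. by rewrite !(commutatorE hmod); exact: comm_sym. Qed.

Lemma commutator_lel a b : commutator a b <=c a.
Proof. by have /con_meet_le[] := @commutator_le_meet _ _ _ a b. Qed.

Lemma commutator_ler a b : commutator a b <=c b.
Proof. by have /con_meet_le[] := @commutator_le_meet _ _ _ a b. Qed.

Lemma commutator_supl X b :
  commutator (con_sup X) b <=c con_sup [set commutator a b | a in X].
Proof.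
rewrite (commutatorE hmod); have := comm_sup hmod (X := X) (b := b).
move/con_le_trans; apply; apply: con_sup_le => _ [a Xa <-].
apply: con_sup_ub; exists a => //.
exact: commutatorE.
Qed.

Lemma commutator_joinl a b c :
  commutator (a \/c b) c <=c commutator a c \/c commutator b c.
Proof. by rewrite !(commutatorE hmod); exact: comm_joinl. Qed.

Lemma commutator_monol a b c : a <=c b -> commutator a c <=c commutator b c.
Proof.
move=> ab; rewrite !(commutatorE hmod) => x y xy.
have cxy := comm_ler xy; move/(commP hmod) : xy => /(_ cxy) xy.
apply/(commP hmod b cxy); move: xy; apply: con_Delta_le => u v /ab.
exact: con_Delta_mem.
Qed.

Lemma commutator_mono a b c t : a <=c b -> c <=c t ->
  commutator a c <=c commutator b t.
Proof.
move=> ab ct; apply: con_le_trans (@commutator_monol _ _ c ab) _.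
by rewrite ![commutator b _]commutatorC; exact: commutator_monol.
Qed.

(** In con_Delta 'Nabla b the diagonal lies in one class, which semidegeneracy
    forces to be everything. *)
Lemma commutator_topl b : commutator 'Nabla b = b.
Proof.
apply: con_le_anti; first exact: commutator_ler.
rewrite (commutatorE hmod) => x y bxy; apply/(commP hmod 'Nabla bxy).
have := @semidegenerate_top _ _ hsd (pair_member b) (con_Delta 'Nabla b) (diag b y).
move=> -> //.
move=> o; rewrite -(@diag_hom _ _ b o (fun=> y)); exact: con_Delta_mem.
Qed.

Lemma commutator_join_join a b t :
  commutator (t \/c a) (t \/c b) <=c t \/c commutator a b.
Proof.
apply: con_le_trans (@commutator_joinl _ _ _) _; apply: con_join_le.
  by apply: con_le_trans (@commutator_lel _ _) _; exact: con_joinl.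
rewrite commutatorC; apply: con_le_trans (@commutator_joinl _ _ _) _.
rewrite [commutator b a]commutatorC; apply: con_join_mono => //.
exact: commutator_lel.
Qed.

Lemma comaximal_commutator a b t : t \/c a = 'Nabla -> t \/c b = 'Nabla ->
  t \/c commutator a b = 'Nabla.
Proof.
move=> ta tb; apply: con_le_anti => //.
rewrite -[con_top in X in X <=c _]commutator_topl.
by rewrite -{1}ta -{1}tb; exact: commutator_join_join.
Qed.

Lemma comaximal_compact t u : t \/c u = 'Nabla ->
  exists c, [/\ con_compact c, c <=c u & t \/c c = 'Nabla].
Proof.
move=> tu; have topC := compact_top hsd (A := A).
have [|c [cc cu tc]] := compact_le_join topC (t := t) (u := u).
  by rewrite tu.
by exists c; split=> //; exact: con_le_anti.
Qed.

(** ** Annihilators *)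

Lemma commutator_perp a : commutator a (con_perp a) = 'Delta.
Proof.
apply: con_le_anti; last exact: con_bot_le.
rewrite commutatorC; apply: con_le_trans (@commutator_supl _ _) _.
by apply: con_sup_le => _ [t ta <-]; rewrite commutatorC ta.
Qed.

Lemma le_perp a b : commutator a b <=c 'Delta -> b <=c con_perp a.
Proof.
move=> ab; apply: con_sup_ub; apply: con_le_anti => //; exact: con_bot_le.
Qed.

Lemma perp_anti a b : a <=c b -> con_perp b <=c con_perp a.
Proof.
by move=> ab; apply: le_perp; rewrite -(commutator_perp b); exact: commutator_monol.
Qed.

Lemma perp_bot : con_perp ('Delta : con A) = 'Nabla.
Proof. by apply: con_le_anti => //; apply: le_perp; exact: commutator_lel. Qed.

Lemma commutator_perp_le a b :
  commutator (con_perp a) (con_perp b) <=c con_perp (a \/c b).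
Proof.
apply: le_perp; apply: con_le_trans (@commutator_joinl _ _ _) _.
apply: con_join_le.
  by rewrite -(commutator_perp a); apply: commutator_mono => //; exact: commutator_lel.
by rewrite -(commutator_perp b); apply: commutator_mono => //; exact: commutator_ler.
Qed.

Lemma comaximal_perp_join t a b : t \/c con_perp a = 'Nabla ->
  t \/c con_perp b = 'Nabla -> t \/c con_perp (a \/c b) = 'Nabla.
Proof.
move=> ta tb; apply: con_joinT_mono (comaximal_commutator ta tb) => //.
exact: commutator_perp_le.
Qed.

(** b = ['Nabla, b] = [t \/ b^perp, b] is below [t, b]. *)
Lemma comaximal_perp_le t b : t \/c con_perp b = 'Nabla -> b <=c t.
Proof.
move=> tb; rewrite -[b in X in X <=c _]commutator_topl -tb.
apply: con_le_trans (@commutator_joinl _ _ _) _.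
rewrite [commutator (con_perp b) b]commutatorC commutator_perp.
by apply: con_join_le; [exact: commutator_lel|exact: con_bot_le].
Qed.

(** ** Prime and maximal congruences *)

Lemma maximal_join p t : con_maximal p -> ~ t <=c p -> p \/c t = 'Nabla.
Proof.
move=> [_ hp] tp; have [e|//] := hp _ (@con_joinl _ _ p t).
by case: tp; rewrite -e; exact: con_joinr.
Qed.

Lemma maximal_le p q : con_maximal p -> con_maximal q -> p <=c q -> p = q.
Proof. by move=> [_ hp] [nq _] /hp[->|]. Qed.

Lemma maximal_prime p : con_maximal p -> con_prime p.
Proof.
move=> mp; split; first exact: mp.1.
move=> a b ab; apply: contrapT => /not_orP[na nb].
apply: mp.1; apply: con_le_anti => //.
rewrite -(comaximal_commutator (maximal_join mp na) (maximal_join mp nb)).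
exact: con_join_le.
Qed.

Lemma proper_le_maximal t : t <> 'Nabla -> exists2 p, con_maximal p & t <=c p.
Proof.
move=> nt; have [||p [tp np pmax]] := @maximal_avoiding _ _ [set 'Nabla] t.
- by move=> _ ->; exact: compact_top.
- by move=> _ ->; exact/con_properP.
exists p => //; split; first by apply/con_properP; exact: np.
move=> a pa; have [->|ap] := pselect (a = p); first by left.
by have [_ -> ?] := pmax a pa ap; right; exact: con_le_anti.
Qed.

Lemma comaximalP t u : (forall p, con_maximal p -> t <=c p -> u <=c p -> False) ->
  t \/c u = 'Nabla.
Proof.
move=> h; apply: contrapT => /proper_le_maximal[p mp tup].
apply: (h p mp); apply: con_le_trans tup; [exact: con_joinl|exact: con_joinr].
Qed.

(** ** Pure congruences *)

Lemma pure_top : con_pure ('Nabla : con A).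
Proof. by move=> a _ _; apply: con_le_anti => //; exact: con_joinl. Qed.

Lemma pure_commutator t u : con_pure t -> con_pure u -> con_pure (commutator t u).
Proof.
move=> pt pu a ca atu; rewrite con_joinC; apply: comaximal_commutator.
  by rewrite con_joinC; apply: pt => //; apply: con_le_trans atu _; exact: commutator_lel.
by rewrite con_joinC; apply: pu => //; apply: con_le_trans atu _; exact: commutator_ler.
Qed.

Lemma compact_le_sup_comaximal_perp X t a :
  (forall u c, X u -> con_compact c -> c <=c u -> t \/c con_perp c = 'Nabla) ->
  con_compact a -> a <=c con_sup X -> t \/c con_perp a = 'Nabla.
Proof.
apply: (compact_sup_ind (Q := fun a => t \/c con_perp a = 'Nabla)).
- by rewrite perp_bot; apply: con_le_anti => //; exact: con_joinr.
- by move=> b c; exact: comaximal_perp_join.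
- by move=> b c bc; apply: con_joinT_mono => //; exact: perp_anti.
Qed.

Lemma Vir_le t : Vir t <=c t.
Proof. by apply: con_sup_le => a []. Qed.

Lemma le_Vir t u : con_pure u -> u <=c t -> u <=c Vir t.
Proof. by move=> pu ut; apply: con_sup_ub. Qed.

Lemma Vir_pure t : con_pure (Vir t).
Proof.
move=> a; apply: compact_le_sup_comaximal_perp => u c [pu ut] cc cu.
by apply: con_joinT_mono (pu c cc cu) => //; exact: le_Vir.
Qed.

Lemma Vir_mono t u : t <=c u -> Vir t <=c Vir u.
Proof.
move=> tu; apply: le_Vir; first exact: Vir_pure.
exact: con_le_trans (@Vir_le _) tu.
Qed.

End Multiplication.

(** * Iterated commutators *)

Section Iterates.
Context {S : signature} {V : variety S}.
Context (hmod : congruence_modular V) (hsd : semidegenerate V) {A : member V}.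
Context (hK : commutator_compact A) (hstar : condition_star A).
Implicit Types (a b c p q r s t u : con A).

Local Notation pow a n := (commutator_iter a a n).

Lemma powS a n : pow a n.+1 = commutator (pow a n) (pow a n).
Proof. by case: n. Qed.

Lemma powD a m n : pow (pow a m) n = pow a (m + n).
Proof.
elim: n => [|n IH]; first by rewrite addn0.
by rewrite addnS !powS IH.
Qed.

Lemma pow_le a m n : (m <= n)%N -> pow a n <=c pow a m.
Proof.
move=> /subnKC <-; elim: (n - m)%N => [|k IH]; first by rewrite addn0.
rewrite addnS powS; apply: con_le_trans IH; exact: commutator_lel.
Qed.

Lemma pow_mono a b n : a <=c b -> pow a n <=c pow b n.
Proof.
move=> ab; elim: n => [//|n IH]; rewrite !powS.
exact: (commutator_mono hmod).
Qed.

Lemma pow_compact a n : con_compact a -> con_compact (pow a n).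
Proof. by move=> ca; elim: n => [//|n IH]; rewrite powS; exact: hK. Qed.

Lemma pow_prime a n p : con_prime p -> pow a n <=c p -> a <=c p.
Proof.
by move=> [_ pp]; elim: n => [//|n IH]; rewrite powS => /pp[]/IH.
Qed.

(** A congruence m maximal among those avoiding all [s^n, a^n], where s^n is
    the n-th iterate and a is compact and not below p, is the required prime.
    If [b, c] <= m with b, c not below m, then m \/ b and m \/ c both contain
    some g = [s^n, a^n] with the same n and a, so m contains [g, g], and by the
    condition on iterated commutators it contains some [s^(n+k), a^(n+k)]. *)
Lemma prime_below_avoiding p s : con_prime p -> con_compact s ->
  (forall n b, con_compact b -> ~ b <=c p -> commutator (pow s n) b <> 'Delta) ->
  exists2 r, con_prime r & r <=c p /\ ~ s <=c r.
Proof.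
move=> pp cs h.
pose F := [set c | exists n a,
  [/\ con_compact a, ~ a <=c p & c = commutator (pow s n) (pow a n)]].
have [||m [_ Fm mmax]] := @maximal_avoiding _ _ F 'Delta.
- by move=> _ [n [a [ca _ ->]]]; apply: hK; exact: pow_compact.
- move=> _ [n [a [ca ap ->]]] le0.
  apply: (h n (pow a n)); [exact: pow_compact|by move/(pow_prime pp)|].
  by apply: con_le_anti => //; exact: con_bot_le.
have mem n a : con_compact a -> ~ a <=c p -> ~ commutator (pow s n) (pow a n) <=c m.
  by move=> ca ap; apply: Fm; exists n, a.
have mp : m <=c p.
  apply: contrapT => /not_leP[a [ca am ap]]; apply: (mem 0%N a ca ap).
  by apply: con_le_trans am; exact: commutator_ler.
have topp : ~ 'Nabla <=c p by move/con_properP: (pp.1).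
exists m; split=> //.
- by move=> em; apply: topp; rewrite -em.
- move=> b c bc; apply: contrapT => /not_orP[bm cm].
  have grow d : ~ d <=c m -> exists n a,
      [/\ con_compact a, ~ a <=c p & commutator (pow s n) (pow a n) <=c m \/c d].
    move=> dm; have [||_ [n [a [ca ap ->]]] ?] := mmax (m \/c d).
    + exact: con_joinl.
    + by move=> e; apply: dm; rewrite -e; exact: con_joinr.
    + by exists n, a.
  have [n1 [a1 [ca1 ap1 le1]]] := grow b bm.
  have [n2 [a2 [ca2 ap2 le2]]] := grow c cm.
  pose n := maxn n1 n2; pose a := commutator a1 a2.
  have ca : con_compact a by exact: hK.
  have ap : ~ a <=c p by move/(pp.2)=> [].
  have le1' : commutator (pow s n) (pow a n) <=c m \/c b.
    apply: con_le_trans le1; apply: (commutator_mono hmod).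
      exact: (@pow_le _ _ _ (leq_maxl n1 n2)).
    apply: con_le_trans (@pow_le _ _ _ (leq_maxl n1 n2)) _.
    by apply: pow_mono; exact: commutator_lel.
  have le2' : commutator (pow s n) (pow a n) <=c m \/c c.
    apply: con_le_trans le2; apply: (commutator_mono hmod).
      exact: (@pow_le _ _ _ (leq_maxr n1 n2)).
    apply: con_le_trans (@pow_le _ _ _ (leq_maxr n1 n2)) _.
    by apply: pow_mono; exact: commutator_ler.
  have csn : con_compact (pow s n) by exact: pow_compact.
  have can : con_compact (pow a n) by exact: pow_compact.
  have [k] := hstar csn can (isT : (0 < 2)%N).
  rewrite !powD; apply: contra_not (mem (n + k)%N a ca ap) => lek.
  apply: con_le_trans lek _ => /=.
  apply: con_le_trans (commutator_mono hmod le1' le2') _.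
  apply: con_le_trans (@commutator_join_join _ _ hmod _ _ _ _) _.
  exact: con_join_le.
- move=> sm; apply: (mem 0%N 'Nabla) => //; first exact: compact_top.
  by apply: con_le_trans sm; exact: commutator_lel.
Qed.

End Iterates.

(** * Separating maximal congruences by annihilating compact ones *)

Section Separation.
Context {S : signature} {V : variety S}.
Context (hmod : congruence_modular V) (hsd : semidegenerate V) {A : member V}.
Implicit Types (a b c p q r s t u : con A).

(** The disjoint open sets zariskiD b and zariskiD s then separate p from q in
    the spectrum. *)
Definition max_separated := forall p q,
  con_maximal p -> con_maximal q -> p <> q ->
  exists s b, [/\ con_compact s, con_compact b, ~ s <=c q, ~ b <=c p
    & commutator s b = 'Delta].

(** The analogue of the ideal of elements that vanish in the localization of
    a ring at p. *)
Definition annihilated_outside p :=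
  con_sup [set c | con_compact c /\ ~ con_perp c <=c p].

Lemma compact_le_annihilated_outside p a : con_prime p -> con_compact a ->
  a <=c annihilated_outside p -> ~ con_perp a <=c p.
Proof.
move=> [np pp]; apply: (compact_sup_ind (Q := fun a => ~ con_perp a <=c p)).
- by rewrite (perp_bot (A := A)); apply/con_properP.
- move=> b c bp cp bcp.
  by have [] := pp _ _ (con_le_trans (@commutator_perp_le _ _ hmod _ b c) bcp).
- move=> b c bc cp bp; apply: cp; apply: con_le_trans bp; exact: (perp_anti hmod).
- move=> t c [_ tp] _ ct cp; apply: tp; apply: con_le_trans cp.
  exact: (perp_anti hmod).
Qed.

Lemma annihilated_outside_le p : con_prime p -> annihilated_outside p <=c p.
Proof.
move=> [_ pp]; apply: con_sup_le => c [_ cp].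
have [|//|//] := pp c (con_perp c).
by rewrite (commutator_perp hmod); exact: con_bot_le.
Qed.

Section Separated.
Context (hsep : max_separated).

Lemma annihilated_outside_not_le p q : con_maximal p -> con_maximal q ->
  p <> q -> ~ annihilated_outside p <=c q.
Proof.
move=> mp mq pq oq; have [s [b [cs cb sq bp sb]]] := hsep mp mq pq.
apply: sq; apply: con_le_trans oq; apply: con_sup_ub; split=> // sp; apply: bp.
by apply: con_le_trans sp; apply: le_perp; rewrite sb.
Qed.

(** For a compact and below this join, no maximal q contains both the join and
    a^perp: the only maximal congruence above the join is p, and a^perp is not
    below p. *)
Lemma annihilated_outside_pure p : con_maximal p -> con_pure (annihilated_outside p).
Proof.
move=> mp a ca aop; apply: (comaximalP hsd) => q mq oq aq.
have pq : p = q.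
  by apply: contrapT => pq; exact: (annihilated_outside_not_le mp mq pq).
by subst q; exact: (compact_le_annihilated_outside (maximal_prime hmod hsd mp) ca aop).
Qed.

Lemma Vir_not_le p q : con_maximal p -> con_maximal q -> p <> q -> ~ Vir p <=c q.
Proof.
move=> mp mq pq vq; apply: (annihilated_outside_not_le mp mq pq).
apply: con_le_trans vq; apply: le_Vir; first exact: annihilated_outside_pure.
exact/annihilated_outside_le/maximal_prime.
Qed.

Lemma comaximal_Vir p q : con_maximal p -> con_maximal q -> p <> q ->
  Vir p \/c Vir q = 'Nabla.
Proof.
move=> mp mq pq; apply: (comaximalP hsd) => r mr pr qr.
have e1 : p = r by apply: contrapT => n; exact: (Vir_not_le mp mr n).
have e2 : q = r by apply: contrapT => n; exact: (Vir_not_le mq mr n).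
by apply: pq; rewrite e1.
Qed.

(** t is comaximal with some compact c below annihilated_outside p, and any
    compact b below c^perp but not below p has c below its annihilator. *)
Lemma exists_comaximal_perp p t : con_maximal p -> ~ t <=c p ->
  exists b, [/\ con_compact b, ~ b <=c p & t \/c con_perp b = 'Nabla].
Proof.
move=> mp tp; have pp := maximal_prime hmod hsd mp.
have [|c [cc co tc]] := @comaximal_compact _ _ hsd A t (annihilated_outside p).
  apply: (comaximalP hsd) => q mq tq oq.
  have pq : p = q.
    by apply: contrapT => pq; exact: (annihilated_outside_not_le mp mq pq).
  by apply: tp; rewrite pq.
have /not_leP[b [cb bc bp]] := compact_le_annihilated_outside pp cc co.
exists b; split=> //; apply: con_joinT_mono tc => //; apply: le_perp.
rewrite (commutatorC hmod) -(commutator_perp hmod c).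
by apply: (commutator_mono hmod).
Qed.

Lemma Vir_le_maximal t p : con_maximal p -> Vir t <=c p -> t <=c p.
Proof.
move=> mp vp; apply: contrapT => tp.
(* The pure congruence that witnesses Vir t not below p. *)
pose w := con_sup [set b | con_compact b /\ t \/c con_perp b = 'Nabla].
have wt : w <=c t by apply: con_sup_le => b [_ /(comaximal_perp_le hmod hsd)].
have mem q : con_maximal q -> ~ t <=c q -> ~ w <=c q.
  move=> mq tq wq; have [b [cb bq tb]] := exists_comaximal_perp mq tq.
  by apply: bq; apply: con_le_trans wq; apply: con_sup_ub.
have pw : con_pure w.
  move=> a ca aw.
  have ta : t \/c con_perp a = 'Nabla.
    move: ca aw; apply: (compact_le_sup_comaximal_perp hmod hsd) => u c [_ tu] _ cu.
    by apply: con_joinT_mono tu => //; exact: (perp_anti hmod).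
  apply: (comaximalP hsd) => q mq wq aq.
  apply: (mem q mq) => // tq; apply: (mq.1); apply: con_le_anti => //.
  by rewrite -ta; exact: con_join_le.
by apply: (mem p mp tp); apply: con_le_trans vp; exact: le_Vir.
Qed.

End Separated.

Lemma separated_of_comaximal_Vir :
  (forall p q, con_maximal p -> con_maximal q -> p <> q ->
     Vir p \/c Vir q = 'Nabla) -> max_separated.
Proof.
move=> h p q mp mq pq; have vpq := h p q mp mq pq.
have /not_leP[s [cs sp sq]] : ~ Vir p <=c q.
  move=> vq; apply: (mq.1); apply: con_le_anti => //; rewrite -vpq.
  by apply: con_join_le => //; exact: Vir_le.
have /not_leP[b [cb bs bp]] : ~ con_perp s <=c p.
  move=> sp'; apply: (mp.1); apply: con_le_anti => //.
  rewrite -(Vir_pure hmod hsd cs sp); apply: con_join_le => //; exact: Vir_le.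
exists s, b; split=> //; apply: con_le_anti; last exact: con_bot_le.
by rewrite -(commutator_perp hmod s); exact: (commutator_mono hmod).
Qed.

Section ReflectsMaximal.
Context (hVir : forall t p, con_maximal p -> Vir t <=c p -> t <=c p).

Lemma comaximal_Vir_of_le p q : con_maximal p -> con_maximal q -> p <> q ->
  Vir p \/c Vir q = 'Nabla.
Proof.
move=> mp mq pq; apply: (comaximalP hsd) => r mr pr qr; apply: pq.
by rewrite (maximal_le mp mr (hVir mr pr)) (maximal_le mq mr (hVir mr qr)).
Qed.

Lemma normal_of_Vir_le : congruence_normal A.
Proof.
move=> t u tu.
have [|s [cs sv us]] := @comaximal_compact _ _ hsd A u (Vir t).
  apply: (comaximalP hsd) => q mq uq vq.
  apply: (mq.1); apply: con_le_anti => //; rewrite -tu.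
  by apply: con_join_le => //; exact: hVir.
exists (con_perp s), s; split=> //.
  by apply: con_joinT_mono (Vir_pure hmod hsd cs sv) => //; exact: Vir_le.
by rewrite (commutatorC hmod) (commutator_perp hmod).
Qed.

(** If p and q were distinct, separation would give s not below q with s^perp
    not below p.  The pure congruences v = Vir (s^perp) and u = Vir (v^perp)
    satisfy [u, v] = 'Delta, so one of them is below x; but v is not below p
    and u is not below q. *)
Lemma purely_prime_maximal_unique x p q : con_purely_prime x ->
  con_maximal p -> con_maximal q -> x <=c p -> x <=c q -> p = q.
Proof.
move=> [_ _ xx] mp mq xp xq; apply: contrapT => pq.
have [s [b [cs cb sq bp sb]]] :=
  separated_of_comaximal_Vir comaximal_Vir_of_le mp mq pq.
pose v := Vir (con_perp s); pose u := Vir (con_perp v).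
have [|ux|vx] := xx u v (@Vir_pure _ _ hmod hsd _ _) (@Vir_pure _ _ hmod hsd _ _).
- apply: (@con_le_trans _ _ _ 'Delta); last exact: con_bot_le.
  rewrite -(commutator_perp hmod v) (commutatorC hmod u).
  by apply: (commutator_mono hmod) => //; exact: Vir_le.
- apply: sq; have := hVir mq (con_le_trans ux xq); apply: con_le_trans.
  apply: le_perp; rewrite (commutatorC hmod) -(commutator_perp hmod s).
  by apply: (commutator_mono hmod) => //; exact: Vir_le.
- apply: bp; have := hVir mp (con_le_trans vx xp); apply: con_le_trans.
  by apply: le_perp; rewrite sb.
Qed.

(** With p the only maximal congruence above x, every compact c below Vir p has
    c^perp not below p, hence comaximal with x, and so c is below x. *)
Lemma purely_prime_eq_Vir (x : con A) : con_purely_prime x ->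
  exists2 p, con_maximal p & x = Vir p.
Proof.
move=> px; have [pux nx _] := px.
have [p mp xp] := proper_le_maximal hsd nx.
exists p => //; apply: con_le_anti; first exact: le_Vir.
move=> y z vyz.
have vy : con_pair y z <=c Vir p by apply/con_pair_le.
apply/con_pair_le; apply: (comaximal_perp_le hmod hsd).
apply: (comaximalP hsd) => q mq xq yq.
have e := purely_prime_maximal_unique px mp mq xp xq; subst q.
apply: (mp.1); apply: con_le_anti => //.
rewrite -(Vir_pure hmod hsd (@compact_pair _ _ y z) vy).
by apply: con_join_le => //; exact: Vir_le.
Qed.

End ReflectsMaximal.

Lemma Vir_purely_prime p : con_maximal p -> con_purely_prime (Vir p).
Proof.
move=> mp; split; first exact: (Vir_pure hmod hsd).
  move=> e; apply: (mp.1); apply: con_le_anti => //; rewrite -e; exact: Vir_le.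
move=> a b pa pb ab.
have [|ap|bp] := (maximal_prime hmod hsd mp).2 a b.
- by apply: con_le_trans ab _; exact: Vir_le.
- by left; exact: le_Vir.
- by right; exact: le_Vir.
Qed.

End Separation.

Arguments max_separated {S V} A.

(** * Topology of the spectra *)

Lemma normal_space_openP (T : topologicalType) : normal_space T <->
  forall B C : set T, closed B -> closed C -> B `&` C = set0 ->
  exists U W, [/\ open U, open W, B `<=` U, C `<=` W & U `&` W = set0].
Proof.
split=> [nT B C cB cC BC|sep B cB N /set_nbhsP[U [oU BU UN]]].
  have [|N nN NC] := nT B cB (~` C).
    apply/set_nbhsP; exists (~` C); split=> //; first exact: closed_openC.
    exact/disjoints_subset.
  have /set_nbhsP[U [oU BU UN]] := nN.
  exists U, (~` closure N); split=> //.
  - exact/closed_openC/closed_closure.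
  - exact/subsetCr.
  - apply/disjoints_subset; rewrite setCK.
    exact: subset_trans UN (@subset_closure _ _).
have [||U' [W [oU' oW BU' UW UW0]]] := sep B (~` U) cB.
- exact: open_closedC.
- by apply/disjoints_subset; rewrite setCK.
exists U'; first by apply/set_nbhsP; exists U'; split.
apply: subset_trans UN; apply: (@subset_trans _ (~` W)); last first.
  by move=> x Wx; apply: contrapT => /UW.
rewrite [X in _ `<=` X](closure_id _).1; last exact: open_closedC.
exact/closureS/disjoints_subset.
Qed.

Section Spectrum.
Context {S : signature} {V : variety S}.
Context (hmod : congruence_modular V) (hsd : semidegenerate V) {A : member V}.
Implicit Types (a b t u p q : con A) (x y : Spec A) (m n : Max A).

Lemma closed_zariskiV t : closed (@zariskiV _ _ A t).
Proof.
rewrite -[zariskiV t]setCK; apply: open_closedC.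
by apply/zariski_openE; exists t.
Qed.

Lemma closed_zariskiP (C : set (Spec A)) : closed C -> exists t, C = zariskiV t.
Proof.
move=> /closed_openC/zariski_openE[t Ct]; exists t.
by rewrite -[C]setCK Ct setCK.
Qed.

Lemma open_down (U : set (Spec A)) x y : open U -> sval x <=c sval y -> U y -> U x.
Proof.
move=> /zariski_openE[t ->] xy ty tx; apply: ty; exact: con_le_trans xy.
Qed.

Lemma Spec_eq x y : sval x = sval y -> x = y.
Proof. by case: x y => x hx [y hy] /=; exact: eq_exist. Qed.

Definition max_spec p (mp : con_maximal p) : Spec A :=
  exist _ p (maximal_prime hmod hsd mp).

Definition max_point p (mp : con_maximal p) : Max A :=
  SigSub (mem_set (mp : Max A (max_spec mp))).

Lemma maxP m : con_maximal (sval (set_val m)).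
Proof. exact: (set_valP m). Qed.

Lemma Max_eq m n : sval (set_val m) <=c sval (set_val n) -> m = n.
Proof.
move=> mn; apply: val_inj; apply: Spec_eq.
exact: (maximal_le (maxP m) (maxP n)).
Qed.

Lemma continuous_set_val : continuous (set_val : Max A -> Spec A).
Proof. by apply/continuousP => U oU; exists U. Qed.

Lemma prime_le_maximal x : exists m, sval x <=c sval (set_val m).
Proof.
by have [p mp xp] := proper_le_maximal hsd (svalP x).1; exists (max_point mp).
Qed.

Lemma normal_space_of_normal : congruence_normal A -> normal_space (Spec A).
Proof.
move=> nA; apply/normal_space_openP => B C /closed_zariskiP[t ->].
move=> /closed_zariskiP[u ->] tu0.
have [|a [b [ta ub ab]]] := nA t u.
  apply: (comaximalP hsd) => p mp tp up.
  by have : (zariskiV t `&` zariskiV u) (max_spec mp); [split|rewrite tu0].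
exists (zariskiD a), (zariskiD b); split.
- by apply/zariski_openE; exists a.
- by apply/zariski_openE; exists b.
- move=> x tx ax; apply: ((svalP x).1); apply: con_le_anti => //.
  by rewrite -ta; exact: con_join_le.
- move=> x ux bx; apply: ((svalP x).1); apply: con_le_anti => //.
  by rewrite -ub; exact: con_join_le.
- apply/seteqP; split=> // x [ax bx].
  have [|//|//] := (svalP x).2 a b.
  by rewrite ab; exact: con_bot_le.
Qed.

(** A prime x goes to a maximal congruence above it.  If t is not below that
    congruence p, then disjoint open neighbourhoods of the closed sets
    {p} = zariskiV p and zariskiV t are closed downwards, so no prime in the
    first one is sent above t. *)
Lemma retraction_of_normal_space : normal_space (Spec A) ->
  exists gamma : Spec A -> Max A,
    continuous gamma /\ (forall m, gamma (set_val m) = m).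
Proof.
move=> /normal_space_openP sep.
have /choice[gamma le_gamma] := prime_le_maximal.
exists gamma; split; last by move=> m; apply/esym/Max_eq; exact: le_gamma.
apply/continuousP => U [W /zariski_openE[t ->] <-]; rewrite openE => x tx.
set p := sval (set_val (gamma x)) in tx.
have [|||U' [W' [oU oW pU tW UW]]] := sep (zariskiV p) (zariskiV t).
- exact: closed_zariskiV.
- exact: closed_zariskiV.
- apply/seteqP; split=> // y [py ty]; apply: tx; rewrite /zariskiV /=.
  have [<- //|e] := (maxP (gamma x)).2 _ py.
  by case: (svalP y).1.
apply: (@filterS _ _ _ U'); last first.
  apply: open_nbhs_nbhs; split=> //; apply: (open_down oU (le_gamma x)).
  exact: pU.
move=> y Uy ty; suff : (U' `&` W') y by rewrite UW.
by split=> //; apply: (open_down oW (le_gamma y)); exact: tW.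
Qed.

(** The retraction gamma preserves the order, since the preimage of a closed
    set is closed and therefore closed upwards.  So gamma x is the maximal
    congruence above x, and Lambda p is the preimage of {p}. *)
Lemma closed_Lambda_of_retraction (gamma : Spec A -> Max A) : continuous gamma ->
  (forall m, gamma (set_val m) = m) ->
  forall p, con_maximal p -> closed (Lambda A p).
Proof.
move=> cg gK p mp; pose g x : Spec A := set_val (gamma x).
have cg' : continuous g.
  by move=> x; apply: continuous_comp; [exact: cg|exact: continuous_set_val].
have preim t : closed (g @^-1` zariskiV t).
  by apply: closed_comp => [x _|]; [exact: cg'|exact: closed_zariskiV].
have mono x y : sval x <=c sval y -> sval (g x) <=c sval (g y).
  move=> xy; have [t ht] := closed_zariskiP (preim (sval (g x))).
  have : zariskiV t x by rewrite -ht => ? ?.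
  move=> tx; have : zariskiV t y by exact: con_le_trans xy.
  by rewrite -ht.
have gmax m : g (set_val m) = set_val m by rewrite /g gK.
suff -> : Lambda A p = g @^-1` zariskiV p by exact: preim.
apply/seteqP; split=> x.
  move=> /(mono x (set_val (max_point mp))); rewrite gmax => gxp.
  by rewrite /zariskiV /= (maximal_le (maxP (gamma x)) mp gxp).
rewrite /zariskiV /= => pg.
have [m xm] := prime_le_maximal x.
have := mono x _ xm; rewrite gmax => gm.
have e : p = sval (set_val m).
  exact: maximal_le mp (maxP m) (con_le_trans pg gm).
by rewrite /Lambda /= e.
Qed.

Lemma separated_of_closed_Lambda : commutator_compact A -> condition_star A ->
  (forall p, con_maximal p -> closed (Lambda A p)) -> max_separated A.
Proof.
move=> hK hstar cl p q mp mq pq.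
have [t Lt] := closed_zariskiP (cl p mp).
have /not_leP[s [cs st sq]] : ~ t <=c q.
  move=> tq; have : zariskiV t (max_spec mq) by [].
  by rewrite -Lt => /(maximal_le mq mp)/esym.
apply: contrapT => hno.
have [||r pr [rp sr]] := prime_below_avoiding hmod hsd hK hstar (p := p) _ cs.
- exact: maximal_prime.
- move=> n b cb bp sb; apply: hno; exists (commutator_iter s s n), b; split=> //.
    exact: pow_compact.
  by move/(pow_prime (maximal_prime hmod hsd mq)).
have : Lambda A p (exist _ r pr) by [].
by rewrite Lt => tr; apply: sr; exact: con_le_trans tr.
Qed.

(** ** The pure spectrum *)

(** The sets pureD w, for w pure, form a base, as the commutator of two pure
    congruences is pure. *)
Lemma pureD_base (U : set (PureSpec A)) (z : PureSpec A) : open U -> U z ->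
  exists w, [/\ con_pure w, ~ w <=c sval z & pureD w `<=` U].
Proof.
move=> [D' D'fin <-] [X D'X Xz].
have [F Fsub XE] : finI_from [set @pureD _ _ A t | t in con_pure (A := A)] id X.
  exact: D'fin.
suff [w [pw wz wF]] : exists w, [/\ con_pure w, ~ w <=c sval z &
    forall i, i \in enum_fset F -> pureD w `<=` i].
  exists w; split=> // y wy; exists X => //; suff : X y by [].
  by rewrite -XE => i iF; exact: (wF i iF).
have pureF i : i \in enum_fset F -> exists2 t, con_pure t & pureD t = i.
  by move=> /Fsub; rewrite inE => -[t pt <-]; exists t.
have zF i : i \in enum_fset F -> i z.
  by move=> iF; have : X z by []; rewrite -XE; apply.
elim: (enum_fset F) pureF zF => [|i s IH] pureF zF.
  exists 'Nabla; split=> //; first exact: pure_top.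
  by apply/con_properP; have [] := svalP z.
have [||w [pw wz ws]] := IH.
- by move=> j js; apply: pureF; rewrite inE js orbT.
- by move=> j js; apply: zF; rewrite inE js orbT.
have [t pt ti] := pureF i (mem_head _ _).
have tz : ~ t <=c sval z by have := zF i (mem_head _ _); rewrite -ti.
exists (commutator t w); split.
- exact: pure_commutator.
- by have [_ _ zz] := svalP z => /zz[].
- move=> j; rewrite inE => /orP[/eqP ->|/ws js] y twy.
    by rewrite -ti => ty; apply: twy; apply: con_le_trans ty; exact: commutator_lel.
  by apply: js => wy; apply: twy; apply: con_le_trans wy; exact: commutator_ler.
Qed.

Lemma open_pureD t : con_pure t -> open (pureD (A := A) t).
Proof.
move=> pt; exists [set pureD t]; last by rewrite bigcup_set1.
move=> _ ->; pose D := [set @pureD _ _ A t | t in con_pure (A := A)].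
by have := @finI_from1 _ _ D id (pureD t); apply; exists t.
Qed.

(** The open set zariskiD t of maximal congruences corresponds to
    pureD (Vir t). *)
Lemma homeomorphism_of_Vir_le :
  (forall t p, con_maximal p -> Vir t <=c p -> t <=c p) ->
  exists eta : Max A -> PureSpec A,
    (forall m, sval (eta m) = Vir (sval (set_val m))) /\ homeomorphism eta.
Proof.
move=> hVir.
pose eta m : PureSpec A := exist _ _ (Vir_purely_prime hmod hsd (maxP m)).
exists eta; split=> //; split.
  apply/continuousP => U oU; rewrite openE => m /(pureD_base oU)[w [pw wm wU]].
  apply: (@filterS _ _ _ (set_val @^-1` zariskiD w)).
    move=> n wn; apply: wU => wv; apply: wn; apply: con_le_trans wv _; exact: Vir_le.
  apply: open_nbhs_nbhs; split.
    by exists (zariskiD w) => //; apply/zariski_openE; exists w.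
  by move=> wm'; apply: wm; exact: le_Vir.
have etaK (z : PureSpec A) : exists m, eta m = z.
  have [p mp zp] := purely_prime_eq_Vir hmod hsd hVir (svalP z).
  exists (max_point mp); move: zp; case: z => z hz /= zp.
  by apply: eq_exist; rewrite zp.
have /choice[g gK] := etaK.
have eta_inj m n : eta m = eta n -> m = n.
  move=> /(congr1 sval) /= e; apply: Max_eq; apply: hVir (maxP n) _.
  by rewrite e; exact: Vir_le.
exists g; split=> //; first by move=> m; exact: eta_inj.
apply/continuousP => U [W /zariski_openE[t ->] <-].
suff -> : g @^-1` (set_val @^-1` zariskiD t) = pureD (Vir t).
  by apply: open_pureD; exact: Vir_pure.
apply/seteqP; split=> z; rewrite /preimage /zariskiD /zariskiV /pureD /=.
  move=> tg tz; apply: tg; apply: hVir (maxP _) _; apply: con_le_trans tz _.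
  by rewrite -{1}[z]gK; exact: Vir_le.
move=> tz tg; apply: tz; rewrite -{1}[z]gK /=; exact: Vir_mono.
Qed.

(** If t is not below p, some pure w not below p is such that every maximal
    congruence above t is above w.  Purity of w turns this into w <= t, hence
    w <= Vir t, and so Vir t is not below p. *)
Lemma Vir_le_of_homeomorphism (eta : Max A -> PureSpec A) :
  (forall m, sval (eta m) = Vir (sval (set_val m))) -> homeomorphism eta ->
  forall t p, con_maximal p -> Vir t <=c p -> t <=c p.
Proof.
move=> etaE [_ [g [etaK _ cg]]] t p mp vp; apply: contrapT => tp.
pose B := g @^-1` (set_val @^-1` zariskiD t).
have oB : open B.
  move/continuousP: cg; apply; exists (zariskiD t) => //.
  by apply/zariski_openE; exists t.
have [|w [pw wp wB]] := pureD_base (z := eta (max_point mp)) oB.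
  by rewrite /B /preimage /= etaK.
have wt : w <=c t.
  move=> y z wyz; apply/con_pair_le; apply: (comaximal_perp_le hmod hsd).
  have cw : con_pair y z <=c w by apply/con_pair_le.
  apply: (comaximalP hsd) => q mq tq cq; apply: (mq.1); apply: con_le_anti => //.
  rewrite -(pw _ (@compact_pair _ _ y z) cw); apply: con_join_le => //.
  apply: contrapT => wq; have : B (eta (max_point mq)).
    apply: wB; rewrite /pureD /= etaE => wv; apply: wq.
    by apply: con_le_trans wv _; exact: Vir_le.
  by rewrite /B /preimage /= etaK; apply.
apply: wp; rewrite etaE /=; apply: le_Vir => //.
by apply: con_le_trans vp; exact: le_Vir.
Qed.

End Spectrum.

Section Radical.
Context {S : signature} {V : variety S} {A : member V}.
Implicit Types (t p : con A).

Lemma le_Rad t : t <=c Rad t.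
Proof. by move=> x y txy _ [z [_ tz] <-]; exact: tz. Qed.

Lemma Rad_le_maximal (hmod : congruence_modular V) (hsd : semidegenerate V) t p :
  con_maximal p -> t <=c p -> Rad t <=c p.
Proof.
move=> mp tp x y; apply.
by exists (max_spec hmod hsd mp).
Qed.

End Radical.

Theorem proposition8p8 (S : signature) (V : variety S)
  (hmod : congruence_modular V) (hsd : semidegenerate V)
  (A : member V) (hK : commutator_compact A) (hstar : condition_star A) :
  [<-> (* 1 *) congruence_normal A;
       (* 2 *) normal_space (Spec A);
       (* 3 *) exists gamma : Spec A -> Max A,
                 continuous gamma /\ (forall p : Max A, gamma (set_val p) = p);
       (* 4 *) forall p : con A, con_maximal p -> closed (Lambda A p);
       (* 5 *) forall p q : con A, con_maximal p -> con_maximal q -> p <> q ->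
                 Vir p \/c Vir q = 'Nabla;
       (* 6 *) forall t p : con A, con_maximal p -> Vir t <=c p -> t <=c p;
       (* 7 *) forall t : con A,
                 Max A `&` zariskiV t = Max A `&` zariskiV (Vir t);
       (* 8 *) forall t : con A, Rad t = Rad (Vir t);
       (* 9 *) exists eta : Max A -> PureSpec A,
                 (forall p : Max A, sval (eta p) = Vir (sval (set_val p))) /\
                 homeomorphism eta].
Proof.
tfae.
- exact: normal_space_of_normal.
- exact: retraction_of_normal_space.
- by move=> [gamma [cg gK]]; exact: closed_Lambda_of_retraction cg gK.
- move=> cl p q; apply: (comaximal_Vir hmod hsd).
  exact: separated_of_closed_Lambda.
- move=> com t p; apply: (Vir_le_maximal hmod hsd).
  exact: separated_of_comaximal_Vir.
- move=> hVir t; apply/seteqP; split=> x [mx tx]; split=> //.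
    by apply: con_le_trans tx; exact: Vir_le.
  exact: hVir.
- by move=> h t; rewrite /Rad (h t).
- move=> hRad; apply: homeomorphism_of_Vir_le => // t p mp vp.
  apply: con_le_trans (@le_Rad _ _ _ t) _.
  by rewrite hRad; exact: Rad_le_maximal.
- move=> [eta [etaE heta]]; apply: normal_of_Vir_le => //.
  exact: Vir_le_of_homeomorphism etaE heta.
Qed.
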